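(* Let $M_1$ and $M_2$ be two real analytic tubular hypersurfaces in $\mathbb C^2$ of finite type $k>2$ at the origin, given by $v=F(x)$ and $v=G(x)$ respectively, and tangent to the hyperplane $\{v=0\}$ at the origin. If $\Psi$ is a local biholomorphism preserving the origin which maps $M_1$ to $M_2$, then it has the form $$z^*=az+ibw,\qquad w^*=cw$$ for some $a,c\in\mathbb R^*$ and $b\in\mathbb R$. In this case $F$ and $G$ satisfy $$G\bigl(ax-bF(x)\bigr)=c\,F(x).$$
   Context: Coordinates in $\mathbb C^2$ are $(z,w)$ with $z=x+iy$, $w=u+iv$; the image coordinates are $(z^*,w^* )$. Throughout the paper, hypersurfaces $v=F(z,\bar z,u)$ pass through the origin with tangent hyperplane $\{v=0\}$ there; for a tube $v=F(x)$, finite type $k>2$ at the origin then means $F(x)=c_1x^k+o(x^k)$ with $c_1\in\mathbb R$, $c_1\neq0$ (and similarly for $G$). *)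

(* Defs.v *)
From Stdlib Require Export Reals.
From Coquelicot Require Export Coquelicot.
Open Scope R_scope.

Definition real_analytic_at (F : R -> R) (x0 : R) : Prop :=
  exists (a : nat -> R) (r : R), 0 < r /\
    forall x : R, Rabs (x - x0) < r -> is_pseries a (x - x0) (F x).

(* Only the germ of [F] at the origin is used, so [F] is a total function whose
   values away from [0] are irrelevant.  [is_domin (locally 0) f g] is
   g = o(f) at 0. *)
Definition finite_type (k : nat) (F : R -> R) : Prop :=
  exists c1 : R, c1 <> 0 /\
    is_domin (locally 0) (fun x : R => x ^ k) (fun x : R => F x - c1 * x ^ k).

(* The hypersurface v = F(x), where (z, w) = (x + iy, u + iv). *)
Definition tube (F : R -> R) (p : C * C) : Prop :=
  Im (snd p) = F (Re (fst p)).

(* The last two conditions say that v = F(x) passes through the origin with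
   tangent hyperplane {v = 0}. *)
Definition analytic_tube_at_origin (F : R -> R) : Prop :=
  locally 0 (fun x : R => real_analytic_at F x) /\ F 0 = 0 /\ is_derive F 0 0.

Definition pterm2 (a : nat -> nat -> C) (z w : C) (m l : nat) : C :=
  (a m l * z ^ m * w ^ l)%C.

(* Holomorphy at a point of C^2: the function is the sum of an absolutely
   convergent power series on a polydisc about the point.  The double series is
   grouped by total degree n = m + l; given the absolute convergence, its sum
   does not depend on this choice. *)
Definition holomorphic_at (f : C * C -> C) (p : C * C) : Prop :=
  exists (a : nat -> nat -> C) (r : R), 0 < r /\
    forall z w : C, Cmod (z - fst p) < r -> Cmod (w - snd p) < r ->
      ex_series (fun n : nat =>
        sum_n (fun m : nat =>
          Cmod (pterm2 a (z - fst p) (w - snd p) m (n - m))) n) /\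
      is_series (fun n : nat =>
        sum_n (fun m : nat =>
          pterm2 a (z - fst p) (w - snd p) m (n - m)) n) (f (z, w)).

Definition holomorphic_map_on (U : C * C -> Prop) (Psi : C * C -> C * C) : Prop :=
  forall p : C * C, U p ->
    holomorphic_at (fun q => fst (Psi q)) p /\
    holomorphic_at (fun q => snd (Psi q)) p.

Definition biholomorphism (U V : C * C -> Prop) (Psi : C * C -> C * C) : Prop :=
  holomorphic_map_on U Psi /\ (forall p, U p -> V (Psi p)) /\
  exists Phi : C * C -> C * C,
    holomorphic_map_on V Phi /\ (forall q, V q -> U (Phi q)) /\
    (forall p, U p -> Phi (Psi p) = p) /\
    (forall q, V q -> Psi (Phi q) = q).

Definition origin : C * C := (RtoC 0, RtoC 0).

Definition local_biholomorphism_at (p : C * C) (Psi : C * C -> C * C) : Prop :=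
  exists U V : C * C -> Prop,
    open U /\ open V /\ U p /\ biholomorphism U V Psi.

(* An inclusion suffices: when [Psi] is a local biholomorphism and the [Mi] are
   graphs of analytic functions, it gives equality of the germs. *)
Definition maps_germ (Psi : C * C -> C * C) (M1 M2 : C * C -> Prop) : Prop :=
  locally origin (fun p => M1 p -> M2 (Psi p)).

(* Main.v *)
Require Import Defs.
From Stdlib Require Import Lra Lia ClassicalEpsilon.

(** Give [z] weight 1 and [w] weight [k].  As [F x] is asymptotic to [c1 x^k], the
    dilations [(z, w) -> (t z, t^k w)] deform the hypersurface [v = F x] into the
    model [v = c1 x^k] when [t] tends to 0.  Hence the leading weighted
    homogeneous part of an identity which [Psi = (f, g)] satisfies along
    [v = F x] is an identity between polynomials on the model
    ([leading_limit]).  The proof reads the identity [Im g = G (Re f)] in this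
    way, weight after weight.

    In weights up to [k], the identity says that [g] starts in weight [k] and that
    [Im (B z^k + ga w) = c2 (Re (al z))^k] on the model ([low_order_g]), where
    [al] and [ga] are the coefficients of [z] in [f] and of [w] in [g].  Since
    [Im (B z^k)] is harmonic, applying the Laplacian shows that [(Re (al z))^(k-2)]
    is proportional to [x^(k-2)]; as [k > 2], [al] is real, and then [B = 0]
    ([levi_degenerate_line]).  Geometrically, the model is Levi degenerate exactly
    along [x = 0], and a map has to preserve this set.  Invertibility of [Psi] gives
    [al <> 0] and [ga <> 0] ([jacobian_injective]).

    Now write [f = al z + i be w + f'] and [g = ga w + g'], where [be] is the imaginary
    part of the coefficient of [w] in [f], and suppose that [f'] and [g'] start in
    weights at least [1 + j] and [k + j] with [j >= 1].  With
    [X = al x - be F x], the identity becomes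
    [Im g' - (G (X + Re f') - G X) = G X - ga F x].  Its right-hand side is a
    function of [x] alone, whatever [F] and [G] are, while by the mean value
    theorem the leading part of its left-hand side is
    [Im g'_(k+j) - A x^(k-1) Re f'_(1+j)] with [A = k c2 al^(k-1)]
    ([increment_limit]).  So this last expression does not depend on [y] and [u] on
    the model, which forces [f'_(1+j) = 0] and [g'_(k+j) = 0]
    ([model_rigidity]).  By induction on [j], [f'] and [g'] vanish
    ([nonlinear_part_vanishes]), and the equation between [F] and [G] is the mapping
    identity at the points [(x, i F x)]. *)

(** * Limits and derivatives of complex-valued functions *)

Definition C_lim (u : nat -> C) (l : C) : Prop :=
  is_lim_seq (fun n => Re (u n)) (Re l) /\ is_lim_seq (fun n => Im (u n)) (Im l).

Definition C_deriv (f : R -> C) (x : R) (l : C) : Prop :=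
  is_derive (fun t => Re (f t)) x (Re l) /\ is_derive (fun t => Im (f t)) x (Im l).

Lemma C_ext (z w : C) : Re z = Re w -> Im z = Im w -> z = w.
Proof.
  destruct z, w; unfold Re, Im; simpl; intros; subst; reflexivity.
Qed.

Lemma Re_plus (z w : C) : Re (z + w)%C = Re z + Re w.
Proof. reflexivity. Qed.

Lemma Im_plus (z w : C) : Im (z + w)%C = Im z + Im w.
Proof. reflexivity. Qed.

Lemma Re_minus (z w : C) : Re (z - w)%C = Re z - Re w.
Proof. reflexivity. Qed.

Lemma Im_minus (z w : C) : Im (z - w)%C = Im z - Im w.
Proof. reflexivity. Qed.

Lemma Im_scal (r : R) (z : C) : Im (RtoC r * z)%C = r * Im z.
Proof. unfold Im, RtoC; simpl; ring. Qed.

Lemma Re_Ci_mult (z : C) : Re (Ci * z)%C = - Im z.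
Proof. unfold Re, Im, Ci; simpl; ring. Qed.

Lemma Im_Ci_mult (z : C) : Im (Ci * z)%C = Re z.
Proof. unfold Re, Im, Ci; simpl; ring. Qed.

Lemma im_le_Cmod (z : C) : Rabs (Im z) <= Cmod z.
Proof.
  rewrite <- (Rabs_Ropp (Im z)), <- Re_Ci_mult.
  apply Rle_trans with (1 := re_le_Cmod _).
  rewrite Cmod_mult, Cmod_Ci; lra.
Qed.

Lemma Cmod_le_abs (z : C) : Cmod z <= Rabs (Re z) + Rabs (Im z).
Proof.
  replace z with (RtoC (Re z) + Ci * RtoC (Im z))%C at 1.
  - apply Rle_trans with (1 := Cmod_triangle _ _).
    rewrite Cmod_mult, Cmod_Ci, !Cmod_R; lra.
  - apply C_ext; unfold Re, Im, RtoC, Ci; simpl; ring.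
Qed.

Lemma C_lim_const (c : C) : C_lim (fun _ => c) c.
Proof. split; apply is_lim_seq_const. Qed.

Lemma C_lim_plus (u v : nat -> C) (l m : C) :
  C_lim u l -> C_lim v m -> C_lim (fun n => (u n + v n)%C) (l + m)%C.
Proof. intros [H1 H2] [H3 H4]; split; apply is_lim_seq_plus'; assumption. Qed.

Lemma C_lim_mult (u v : nat -> C) (l m : C) :
  C_lim u l -> C_lim v m -> C_lim (fun n => (u n * v n)%C) (l * m)%C.
Proof.
  intros [H1 H2] [H3 H4]; split.
  - apply is_lim_seq_minus'; apply is_lim_seq_mult'; assumption.
  - apply is_lim_seq_plus'; apply is_lim_seq_mult'; assumption.
Qed.

Lemma C_lim_pow (u : nat -> C) (l : C) (m : nat) :
  C_lim u l -> C_lim (fun n => (u n ^ m)%C) (l ^ m)%C.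
Proof.
  intros H; induction m; simpl.
  - apply C_lim_const.
  - apply C_lim_mult; assumption.
Qed.

Lemma C_lim_ext (u v : nat -> C) (l : C) :
  (forall n, u n = v n) -> C_lim u l -> C_lim v l.
Proof.
  intros E [H1 H2]; split; (eapply is_lim_seq_ext; [|eassumption]);
    intro n; simpl; rewrite E; reflexivity.
Qed.

Lemma C_lim_sum (u : nat -> nat -> C) (l : nat -> C) (N : nat) :
  (forall i, C_lim (u i) (l i)) ->
  C_lim (fun n => sum_n (fun i => u i n) N) (sum_n l N).
Proof.
  intros H; induction N.
  - rewrite sum_O. apply C_lim_ext with (u 0%nat); [|apply H].
    intro n; rewrite sum_O; reflexivity.
  - rewrite sum_Sn.
    eapply C_lim_ext; [|apply (C_lim_plus _ _ _ _ IHN (H (S N)))].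
    intro n; cbv beta; rewrite sum_Sn; reflexivity.
Qed.

Lemma is_lim_seq_unique_R (u : nat -> R) (l m : R) :
  is_lim_seq u l -> is_lim_seq u m -> l = m.
Proof.
  intros H1 H2; apply is_lim_seq_unique in H1; apply is_lim_seq_unique in H2.
  rewrite H1 in H2; injection H2; auto.
Qed.

Lemma C_lim_unique (u : nat -> C) (l m : C) : C_lim u l -> C_lim u m -> l = m.
Proof.
  intros [H1 H2] [H3 H4]; apply C_ext.
  - exact (is_lim_seq_unique_R _ _ _ H1 H3).
  - exact (is_lim_seq_unique_R _ _ _ H2 H4).
Qed.

Lemma is_lim_seq_pow (u : nat -> R) (l : R) (m : nat) :
  is_lim_seq u l -> is_lim_seq (fun n => u n ^ m) (l ^ m).
Proof.
  intros H; induction m; simpl.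
  - apply is_lim_seq_const.
  - apply is_lim_seq_mult'; assumption.
Qed.

Lemma C_lim_Cmod_bound (u v : nat -> C) (l : C) (e : nat -> R) :
  eventually (fun n => Cmod (u n - v n) <= e n) ->
  is_lim_seq e 0 -> C_lim v l -> C_lim u l.
Proof.
  intros He Le [H1 H2].
  assert (Z : forall P : C -> R, (forall z, Rabs (P z) <= Cmod z) ->
     is_lim_seq (fun n => P (u n - v n)%C) 0).
  { intros P HP.
    apply is_lim_seq_le_le_loc with (u := fun n => - e n) (w := e).
    - destruct He as [N HN]; exists N; intros n Hn.
      specialize (HN n Hn); specialize (HP (u n - v n)%C).
      apply Rabs_le_between; lra.
    - replace (Finite 0) with (Rbar_opp 0) by (simpl; f_equal; ring).
      apply -> is_lim_seq_opp; assumption.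
    - assumption. }
  split.
  - apply is_lim_seq_ext with (fun n => Re (u n - v n)%C + Re (v n)).
    + intro n; rewrite Re_minus; ring.
    + replace (Re l) with (0 + Re l) by ring.
      apply is_lim_seq_plus'; [apply Z, re_le_Cmod | assumption].
  - apply is_lim_seq_ext with (fun n => Im (u n - v n)%C + Im (v n)).
    + intro n; rewrite Im_minus; ring.
    + replace (Im l) with (0 + Im l) by ring.
      apply is_lim_seq_plus'; [apply Z, im_le_Cmod | assumption].
Qed.

Lemma C_lim_bounded (u : nat -> C) (l : C) :
  C_lim u l -> exists rho, 0 < rho /\ eventually (fun n => Cmod (u n) <= rho).
Proof.
  intros [H1 H2].
  exists (Rabs (Re l) + 1 + (Rabs (Im l) + 1)).
  pose proof (Rabs_pos (Re l)); pose proof (Rabs_pos (Im l)).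
  split; [lra|].
  apply is_lim_seq_spec in H1; apply is_lim_seq_spec in H2.
  destruct (H1 (mkposreal 1 Rlt_0_1)) as [N1 K1].
  destruct (H2 (mkposreal 1 Rlt_0_1)) as [N2 K2].
  exists (N1 + N2)%nat; intros n Hn.
  specialize (K1 n ltac:(lia)); specialize (K2 n ltac:(lia)); simpl in K1, K2.
  apply Rle_trans with (1 := Cmod_le_abs _).
  pose proof (Rabs_triang_inv (Re (u n)) (Re l)).
  pose proof (Rabs_triang_inv (Im (u n)) (Im l)).
  lra.
Qed.

Lemma C_deriv_const (c : C) (x : R) : C_deriv (fun _ => c) x 0.
Proof.
  split; [exact (is_derive_const (Re c) x) | exact (is_derive_const (Im c) x)].
Qed.

Lemma C_deriv_plus (f g : R -> C) (x : R) (l m : C) :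
  C_deriv f x l -> C_deriv g x m -> C_deriv (fun t => (f t + g t)%C) x (l + m)%C.
Proof.
  intros [H1 H2] [H3 H4]; split.
  - exact (is_derive_plus _ _ _ _ _ H1 H3).
  - exact (is_derive_plus _ _ _ _ _ H2 H4).
Qed.

Lemma C_deriv_mult (f g : R -> C) (x : R) (l m : C) :
  C_deriv f x l -> C_deriv g x m ->
  C_deriv (fun t => (f t * g t)%C) x (l * g x + f x * m)%C.
Proof.
  intros [H1 H2] [H3 H4]; split.
  - replace (Re (l * g x + f x * m)%C) with
      ((Re l * Re (g x) + Re (f x) * Re m) - (Im l * Im (g x) + Im (f x) * Im m))
      by (unfold Re, Im; simpl; ring).
    exact (is_derive_minus _ _ _ _ _ (is_derive_mult _ _ _ _ _ H1 H3 Rmult_comm)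
       (is_derive_mult _ _ _ _ _ H2 H4 Rmult_comm)).
  - replace (Im (l * g x + f x * m)%C) with
      ((Re l * Im (g x) + Re (f x) * Im m) + (Im l * Re (g x) + Im (f x) * Re m))
      by (unfold Re, Im; simpl; ring).
    exact (is_derive_plus _ _ _ _ _ (is_derive_mult _ _ _ _ _ H1 H4 Rmult_comm)
       (is_derive_mult _ _ _ _ _ H2 H3 Rmult_comm)).
Qed.

Lemma C_deriv_pow (f : R -> C) (x : R) (l : C) (n : nat) :
  C_deriv f x l -> C_deriv (fun t => (f t ^ n)%C) x (RtoC (INR n) * f x ^ pred n * l)%C.
Proof.
  intros H; induction n.
  - simpl. replace (RtoC 0 * 1 * l)%C with (RtoC 0) by ring. apply C_deriv_const.
  - replace (RtoC (INR (S n)) * f x ^ pred (S n) * l)%C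
      with (l * f x ^ n + f x * (RtoC (INR n) * f x ^ pred n * l))%C.
    + exact (C_deriv_mult f (fun t => (f t ^ n)%C) x _ _ H IHn).
    + rewrite S_INR, RtoC_plus. simpl pred.
      destruct n; [simpl; ring|].
      rewrite (Cpow_S (f x) n). simpl pred. ring.
Qed.

Lemma C_deriv_ext (f g : R -> C) (x : R) (l : C) :
  (forall t, f t = g t) -> C_deriv f x l -> C_deriv g x l.
Proof.
  intros E [H1 H2]; split; (eapply is_derive_ext; [|eassumption]);
    intro t; simpl; rewrite E; reflexivity.
Qed.

Lemma C_deriv_sum (f : nat -> R -> C) (x : R) (l : nat -> C) (N : nat) :
  (forall i, C_deriv (f i) x (l i)) ->
  C_deriv (fun t => sum_n (fun i => f i t) N) x (sum_n l N).
Proof.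
  intros H; induction N.
  - rewrite sum_O. apply C_deriv_ext with (f 0%nat); [|apply H].
    intro t; rewrite sum_O; reflexivity.
  - rewrite sum_Sn.
    eapply C_deriv_ext; [|apply (C_deriv_plus _ _ _ _ _ IHN (H (S N)))].
    intro t; cbv beta; rewrite sum_Sn; reflexivity.
Qed.

Lemma Re_sum_n (u : nat -> C) (N : nat) : Re (sum_n u N) = sum_n (fun i => Re (u i)) N.
Proof.
  induction N; rewrite ?sum_O, ?sum_Sn; [reflexivity|].
  rewrite <- IHN; reflexivity.
Qed.

Lemma sum_n_single {V : AbelianMonoid} (x : V) (l0 n : nat) :
  sum_n (fun l => if Nat.eqb l l0 then x else zero) n
  = if Nat.leb l0 n then x else zero.
Proof.
  induction n.
  - rewrite sum_O. destruct l0; reflexivity.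
  - rewrite sum_Sn, IHn.
    destruct (Nat.leb_spec l0 n), (Nat.eqb_spec (S n) l0), (Nat.leb_spec l0 (S n));
      try lia; rewrite ?plus_zero_l, ?plus_zero_r; reflexivity.
Qed.

(** * Power series and their weighted homogeneous parts *)

(** The expansion of [holomorphic_at] at the origin, with the coefficients and the
    radius made explicit so that they can be compared and combined. *)
Definition expands (a : nat -> nat -> C) (r : R) (f : C -> C -> C) : Prop :=
  forall z w : C, Cmod z < r -> Cmod w < r ->
    ex_series (fun n => sum_n (fun m => Cmod (pterm2 a z w m (n - m))) n) /\
    is_series (fun n => sum_n (fun m => pterm2 a z w m (n - m)) n) (f z w).

Lemma holomorphic_expands (f : C * C -> C) :
  holomorphic_at f origin ->
  exists a r, 0 < r /\ expands a r (fun z w => f (z, w)).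
Proof.
  intros (a & r & Hr & H); exists a, r; split; [assumption|].
  intros z w Hz Hw.
  specialize (H z w); unfold origin in H; simpl fst in H; simpl snd in H.
  replace (z - RtoC 0)%C with z in H by ring.
  replace (w - RtoC 0)%C with w in H by ring.
  auto.
Qed.

Lemma expands_shrink (a : nat -> nat -> C) (r r' : R) (f : C -> C -> C) :
  r' <= r -> expands a r f -> expands a r' f.
Proof. intros Hr H z w Hz Hw; apply H; lra. Qed.

Lemma expands_ext (a b : nat -> nat -> C) (r : R) (f g : C -> C -> C) :
  (forall m l, a m l = b m l) -> (forall z w, f z w = g z w) ->
  expands a r f -> expands b r g.
Proof.
  intros E1 E2 H z w Hz Hw; destruct (H z w Hz Hw) as [H1 H2]; split.
  - eapply ex_series_ext; [|exact H1]; intro n; apply sum_n_ext; intro m.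
    unfold pterm2; rewrite E1; reflexivity.
  - rewrite <- E2; eapply is_series_ext; [|exact H2]; intro n; apply sum_n_ext; intro m.
    unfold pterm2; rewrite E1; reflexivity.
Qed.

Lemma expands_lin (a b : nat -> nat -> C) (c : C) (r : R) (f g : C -> C -> C) :
  expands a r f -> expands b r g ->
  expands (fun m l => a m l + c * b m l)%C r (fun z w => f z w + c * g z w)%C.
Proof.
  intros Hf Hg z w Hz Hw.
  destruct (Hf z w Hz Hw) as [F1 F2], (Hg z w Hz Hw) as [G1 G2]; split.
  - apply (ex_series_le (K := R_AbsRing) (V := R_CompleteNormedModule)) with
      (b := fun n => plus (sum_n (fun m => Cmod (pterm2 a z w m (n - m))) n)
        (mult (K := R_Ring) (Cmod c)
          (sum_n (fun m => Cmod (pterm2 b z w m (n - m))) n))).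
    + intro n. rewrite <- (sum_n_mult_l (K := R_Ring)), <- sum_n_plus.
      apply Rle_trans with (1 := norm_sum_n_m (K := R_AbsRing) (V := R_NormedModule) _ _ _).
      apply sum_n_m_le; intro m.
      apply Rle_trans with (Cmod (pterm2 (fun m0 l => a m0 l + c * b m0 l)%C z w m (n - m))).
      { apply Req_le; apply Rabs_pos_eq, Cmod_ge_0. }
      replace (pterm2 (fun m0 l => a m0 l + c * b m0 l)%C z w m (n - m))
        with (pterm2 a z w m (n - m) + c * pterm2 b z w m (n - m))%C
        by (unfold pterm2; ring).
      apply Rle_trans with (1 := Cmod_triangle _ _).
      rewrite Cmod_mult; apply Rle_refl.
    + exact (ex_series_plus (K := R_AbsRing) (V := R_NormedModule) _ _ F1
        (ex_series_scal_l (K := R_AbsRing) (Cmod c) _ G1)).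
  - eapply is_series_ext;
      [|exact (is_series_plus _ _ _ _ F2 (is_series_scal_l c _ _ G2))].
    intro n; cbv beta.
    change (scal c ?s) with (mult (K := C_Ring) c s).
    rewrite <- (sum_n_mult_l (K := C_Ring)), <- sum_n_plus.
    apply sum_n_ext; intro m.
    change (pterm2 a z w m (n - m) + c * pterm2 b z w m (n - m)
      = pterm2 (fun m l => a m l + c * b m l) z w m (n - m))%C.
    unfold pterm2; ring.
Qed.

Lemma expands_sum (a : nat -> nat -> nat -> C) (r : R) (f : nat -> C -> C -> C) (N : nat) :
  (forall i, expands (a i) r (f i)) ->
  expands (fun m l => sum_n (fun i => a i m l) N) r
    (fun z w => sum_n (fun i => f i z w) N).
Proof.
  intros H; induction N.
  - apply expands_ext with (3 := H 0%nat); intros; rewrite sum_O; reflexivity.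
  - eapply expands_ext; [| | exact (expands_lin _ _ (RtoC 1) _ _ _ IHN (H (S N)))];
      intros; cbv beta; rewrite sum_Sn, Cmult_1_l; reflexivity.
Qed.

Lemma is_series_single {K : AbsRing} {V : NormedModule K} (x : V) (n0 : nat) :
  is_series (fun n => if Nat.eqb n n0 then x else zero) x.
Proof.
  apply filterlim_ext_loc with (fun _ => x).
  - exists n0; intros n Hn.
    rewrite sum_n_single; destruct (Nat.leb_spec n0 n); [reflexivity | lia].
  - apply filterlim_const.
Qed.

Definition monomial_coef (c : C) (m0 l0 m l : nat) : C :=
  if Nat.eqb m m0 then if Nat.eqb l l0 then c else 0%C else 0%C.

Lemma expands_monomial (c : C) (m0 l0 : nat) (r : R) :
  expands (monomial_coef c m0 l0) r (fun z w => c * z ^ m0 * w ^ l0)%C.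
Proof.
  intros z w _ _.
  assert (E : forall n m, (m <= n)%nat ->
    pterm2 (monomial_coef c m0 l0) z w m (n - m) =
    if Nat.eqb m m0 then (if Nat.eqb n (m0 + l0) then (c * z ^ m0 * w ^ l0)%C else 0%C)
    else 0%C).
  { intros n m Hm; unfold pterm2, monomial_coef.
    destruct (Nat.eqb_spec m m0); [|ring]; subst m.
    destruct (Nat.eqb_spec (n - m0) l0), (Nat.eqb_spec n (m0 + l0)); try lia;
      [subst l0; reflexivity | ring]. }
  split.
  - exists (Cmod (c * z ^ m0 * w ^ l0)%C).
    eapply is_series_ext; [|apply (is_series_single (K := R_AbsRing)
      (V := R_NormedModule) (Cmod (c * z ^ m0 * w ^ l0)%C) (m0 + l0))].
    intro n; cbv beta.
    rewrite (sum_n_ext_loc (G := R_AbelianMonoid) _ (fun m => if Nat.eqb m m0 then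
      (if Nat.eqb n (m0 + l0) then Cmod (c * z ^ m0 * w ^ l0)%C else 0) else zero)).
    + rewrite (sum_n_single (V := R_AbelianMonoid)).
      destruct (Nat.leb_spec m0 n), (Nat.eqb_spec n (m0 + l0)); try lia; reflexivity.
    + intros m Hm; rewrite E by assumption.
      destruct (Nat.eqb m m0), (Nat.eqb n (m0 + l0)); try reflexivity; apply Cmod_0.
  - eapply is_series_ext; [|apply (is_series_single (K := C_AbsRing)
      (V := C_NormedModule) (c * z ^ m0 * w ^ l0)%C (m0 + l0))].
    intro n; cbv beta.
    rewrite (sum_n_ext_loc (G := C_AbelianMonoid) (fun m => pterm2 _ z w m (n - m))
      (fun m => if Nat.eqb m m0 then
      (if Nat.eqb n (m0 + l0) then (c * z ^ m0 * w ^ l0)%C else RtoC 0) else zero)).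
    + rewrite (sum_n_single (V := C_AbelianMonoid)).
      destruct (Nat.leb_spec m0 n), (Nat.eqb_spec n (m0 + l0)); try lia; reflexivity.
    + intros m Hm; rewrite E by assumption. reflexivity.
Qed.

(** The part of weight [N] of a double series, for the weights 1 of [z] and [k] of
    [w]; the sum runs over the exponent of [w]. *)
Definition weighted_part (k : nat) (a : nat -> nat -> C) (N : nat) (z w : C) : C :=
  sum_n (fun l => if Nat.leb (k * l) N then pterm2 a z w (N - k * l) l else RtoC 0) N.

(** A weighted homogeneous polynomial is its own expansion, so subtracting it from a
    function just erases the coefficients of weight [N]. *)
Lemma expands_weighted_part (k : nat) (a : nat -> nat -> C) (N : nat) (r : R) :
  (1 <= k)%nat ->
  expands (fun m l => if Nat.eqb (m + k * l) N then a m l else RtoC 0) r (weighted_part k a N).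
Proof.
  intros Hk.
  eapply expands_ext; [| |apply (expands_sum (fun i => monomial_coef
    (if Nat.leb (k * i) N then a (N - k * i)%nat i else RtoC 0) (N - k * i) i) r
    (fun i z w => (if Nat.leb (k * i) N then a (N - k * i)%nat i else RtoC 0)
       * z ^ (N - k * i) * w ^ i)%C N); intro i; apply expands_monomial].
  - intros m l; cbv beta.
    rewrite (sum_n_ext_loc (G := C_AbelianMonoid) _ (fun i => if Nat.eqb i l then
      (if Nat.eqb (m + k * l) N then a m l else RtoC 0) else zero)).
    + rewrite (sum_n_single (V := C_AbelianMonoid)).
      destruct (Nat.leb_spec l N), (Nat.eqb_spec (m + k * l) N);
        try reflexivity; nia.
    + intros i Hi; unfold monomial_coef.
      rewrite (Nat.eqb_sym l i).
      destruct (Nat.eqb_spec i l) as [-> | Hil].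
      * destruct (Nat.leb_spec (k * l) N), (Nat.eqb_spec m (N - k * l)),
          (Nat.eqb_spec (m + k * l) N); try reflexivity; try lia.
        subst m; reflexivity.
      * destruct (Nat.eqb m (N - k * i)); reflexivity.
  - intros z w; unfold weighted_part; apply sum_n_ext; intro i.
    destruct (Nat.leb (k * i) N); unfold pterm2; [reflexivity|].
    match goal with |- ?x = ?y => change (@eq C x y) end; ring.
Qed.

Lemma weighted_part_homogeneous (k : nat) (a : nat -> nat -> C) (N : nat) (t : R) (z w : C) :
  weighted_part k a N (RtoC t * z) (RtoC (t ^ k) * w) = (RtoC (t ^ N) * weighted_part k a N z w)%C.
Proof.
  unfold weighted_part.
  rewrite <- (sum_n_mult_l (K := C_Ring)); apply sum_n_ext; intro l.
  change (@mult C_Ring) with Cmult.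
  match goal with |- ?x = ?y => change (@eq C x y) end.
  destruct (Nat.leb_spec (k * l) N); [|ring].
  unfold pterm2; rewrite !Cpow_mult_l, !RtoC_pow, <- Cpow_mult_r.
  replace (RtoC t ^ N)%C with (RtoC t ^ (N - k * l) * RtoC t ^ (k * l))%C
    by (rewrite <- Cpow_add_r; f_equal; lia).
  ring.
Qed.

Lemma sum_n_nonneg (e : nat -> R) (N : nat) : (forall i, 0 <= e i) -> 0 <= sum_n e N.
Proof.
  intros H; induction N; rewrite ?sum_O, ?sum_Sn; [apply H|].
  apply Rplus_le_le_0_compat; [assumption | apply H].
Qed.

Lemma series_Cmod_le (h : nat -> C) (L : C) (e : nat -> R) (S q : R) :
  is_series h L -> is_series e S -> 0 <= q -> (forall n, 0 <= e n) ->
  (forall n, Cmod (h n) <= q * e n) -> Cmod L <= q * S.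
Proof.
  intros Hh He Hq Pe B.
  assert (P : forall n, Cmod (sum_n h n) <= q * S).
  { intro n. apply Rle_trans with (q * sum_n e n).
    - change (q * sum_n e n) with (mult (K := R_Ring) q (sum_n e n)).
      rewrite <- (sum_n_mult_l (K := R_Ring)).
      induction n; [rewrite !sum_O; apply B|].
      rewrite !sum_Sn; apply Rle_trans with (1 := Cmod_triangle _ _).
      apply Rplus_le_compat; [assumption | apply B].
    - apply Rmult_le_compat_l; [assumption|].
      apply (is_lim_seq_incr_compare (sum_n e)); [exact He|].
      intro m; rewrite sum_Sn; unfold plus; simpl; specialize (Pe (Datatypes.S m)); lra. }
  apply le_epsilon; intros eps Heps.
  destruct (Hh (fun x => Cmod (x - L) < eps)) as [n Hn].
  { apply (locally_le_locally_norm (K := C_AbsRing) (V := C_NormedModule)).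
    exists (mkposreal eps Heps); intros y Hy; exact Hy. }
  specialize (Hn n (Nat.le_refl n)); cbv beta in Hn.
  assert (E : forall x : C, Cmod (x - L) < eps -> Cmod x <= q * S -> Cmod L <= q * S + eps).
  { intros x Hx Bx.
    replace L with (x + - (x - L))%C by ring.
    apply Rle_trans with (1 := Cmod_triangle _ _).
    rewrite Cmod_opp; lra. }
  exact (E _ Hn (P n)).
Qed.

(** Absolute convergence at one point [(R0, R0)] dominates the whole series: for
    [t = q t0], a monomial of weight at least [M] is at most [q^M] times its value at
    [(R0, R0)]. *)
Lemma expands_bound (k : nat) (a : nat -> nat -> C) (r : R) (f : C -> C -> C)
  (M : nat) (rho : R) :
  (1 <= k)%nat -> 0 < r -> expands a r f ->
  (forall m l, (m + k * l < M)%nat -> a m l = 0%C) -> 0 < rho ->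
  exists K delta, 0 < delta /\ forall t z w, 0 < t < delta ->
    Cmod z <= rho -> Cmod w <= rho ->
    Cmod (f (RtoC t * z) (RtoC (t ^ k) * w))%C <= K * t ^ M.
Proof.
  intros Hk Hr Hf Ha Hrho.
  set (R0 := r / 2).
  destruct (Hf (RtoC R0) (RtoC R0)) as [[S HS] _].
  1, 2: rewrite Cmod_R, Rabs_pos_eq; unfold R0; lra.
  (* [t0 <= 1] makes [t0^k rho <= t0 rho <= R0], so that both variables stay in the
     polydisc. *)
  set (t0 := Rmin 1 (R0 / rho)).
  assert (HR0 : 0 < R0) by (unfold R0; lra).
  assert (Ht0 : 0 < t0).
  { apply Rmin_glb_lt; [lra|]. apply Rdiv_lt_0_compat; assumption. }
  assert (Ht1 : t0 <= 1) by apply Rmin_l.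
  assert (Ht2 : t0 * rho <= R0).
  { apply Rle_trans with (R0 / rho * rho).
    - apply Rmult_le_compat_r; [lra | apply Rmin_r].
    - right; field; lra. }
  exists (S / t0 ^ M), t0; split; [assumption|].
  intros t z w [Ht Htt] Hz Hw.
  set (q := t / t0).
  assert (Hq : 0 < q < 1).
  { unfold q; split; [apply Rdiv_lt_0_compat; assumption|].
    apply Rmult_lt_reg_r with t0; [assumption|]. unfold Rdiv.
    rewrite Rmult_assoc, Rinv_l; lra. }
  assert (Eq : t = q * t0) by (unfold q; field; lra).
  replace (S / t0 ^ M * t ^ M) with (q ^ M * S)
    by (rewrite Eq, Rpow_mult_distr; field; apply pow_nonzero; lra).
  assert (Bz : Cmod (RtoC t * z) <= q * R0).
  { rewrite Cmod_mult, Cmod_R, Rabs_pos_eq, Eq by lra.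
    pose proof (Cmod_ge_0 z). nra. }
  assert (Bw : Cmod (RtoC (t ^ k) * w) <= q ^ k * R0).
  { rewrite Cmod_mult, Cmod_R, Rabs_pos_eq by (apply pow_le; lra).
    rewrite Eq, Rpow_mult_distr, Rmult_assoc.
    apply Rmult_le_compat_l; [apply pow_le; lra|].
    assert (t0 ^ k <= t0).
    { destruct k; [lia|]. simpl.
      assert (t0 ^ k <= 1) by (rewrite <- (pow1 k); apply pow_incr; lra). nra. }
    pose proof (Cmod_ge_0 w). pose proof (pow_lt t0 k Ht0). nra. }
  assert (Bk : q ^ k <= 1) by (rewrite <- (pow1 k); apply pow_incr; lra).
  assert (Hr' : R0 < r) by (unfold R0; lra).
  destruct (Hf (RtoC t * z)%C (RtoC (t ^ k) * w)%C) as [_ Hs];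
    [nra | nra |].
  apply series_Cmod_le with (1 := Hs) (2 := HS).
  - apply pow_le; lra.
  - intro n; apply sum_n_nonneg; intro m; apply Cmod_ge_0.
  - intro n.
    change (q ^ M * ?s) with (mult (K := R_Ring) (q ^ M) s).
    rewrite <- (sum_n_mult_l (K := R_Ring)).
    apply Rle_trans with (1 := norm_sum_n_m (K := C_AbsRing) (V := C_NormedModule) _ _ _).
    apply sum_n_m_le; intro m.
    change (Cmod (pterm2 a (RtoC t * z)%C (RtoC (t ^ k) * w)%C m (n - m)) <=
      q ^ M * Cmod (pterm2 a (RtoC R0) (RtoC R0) m (n - m))).
    destruct (Nat.lt_ge_cases (m + k * (n - m)) M) as [L | L].
    { unfold pterm2; rewrite (Ha _ _ L), !Cmult_0_l, Cmod_0; lra. }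
    unfold pterm2; rewrite !Cmod_mult, !Cmod_pow, !Cmod_mult, (Cmod_R R0), (Rabs_pos_eq R0) by lra.
    rewrite !Cmod_mult in Bz, Bw.
    set (X := Cmod (RtoC t) * Cmod z) in *. set (Y := Cmod (RtoC (t ^ k)) * Cmod w) in *.
    assert (X0 : 0 <= X) by (apply Rmult_le_pos; apply Cmod_ge_0).
    assert (Y0 : 0 <= Y) by (apply Rmult_le_pos; apply Cmod_ge_0).
    set (l := (n - m)%nat) in *.
    apply Rle_trans with (Cmod (a m l) * (q * R0) ^ m * (q ^ k * R0) ^ l).
    { apply Rmult_le_compat.
      - apply Rmult_le_pos; [apply Cmod_ge_0 | apply pow_le; assumption].
      - apply pow_le; assumption.
      - apply Rmult_le_compat_l; [apply Cmod_ge_0 | apply pow_incr; lra].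
      - apply pow_incr; lra. }
    rewrite !Rpow_mult_distr, <- pow_mult.
    replace (Cmod (a m l) * (q ^ m * R0 ^ m) * (q ^ (k * l) * R0 ^ l))
      with (q ^ (m + k * l) * (Cmod (a m l) * R0 ^ m * R0 ^ l))
      by (rewrite pow_add; ring).
    apply Rmult_le_compat_r.
    + repeat apply Rmult_le_pos; try apply Cmod_ge_0; apply pow_le; lra.
    + replace (m + k * l)%nat with (M + (m + k * l - M))%nat by lia.
      rewrite pow_add. rewrite <- (Rmult_1_r (q ^ M)) at 2.
      apply Rmult_le_compat_l; [apply pow_le; lra|].
      rewrite <- (pow1 (m + k * l - M)); apply pow_incr; lra.
Qed.

(** The dilation parameter runs through a fixed sequence of positive numbers, so that
    all limits are limits of sequences. *)
Definition tau (n : nat) : R := / INR (S n).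

Lemma tau_pos (n : nat) : 0 < tau n.
Proof. apply Rinv_0_lt_compat, lt_0_INR; lia. Qed.

Lemma tau_lim : is_lim_seq tau 0.
Proof.
  apply (is_lim_seq_incr_1 (fun n => / INR n)).
  replace (Finite 0) with (Rbar_inv p_infty) by reflexivity.
  apply is_lim_seq_inv; [apply is_lim_seq_INR | discriminate].
Qed.

Lemma eventually_lt (u : nat -> R) (l d : R) :
  is_lim_seq u l -> l < d -> eventually (fun n => u n < d).
Proof.
  intros H Hd; apply is_lim_seq_spec in H.
  destruct (H (mkposreal (d - l) ltac:(lra))) as [N HN]; exists N; intros n Hn.
  specialize (HN n Hn); simpl in HN; apply Rabs_lt_between in HN; lra.
Qed.

(** Dilating extracts the part of lowest weight: after its subtraction, [expands_bound]
    leaves an error of one order higher.  The arguments may vary with [n], since a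
    point of [v = F x] is dilated into a point that only tends to the model. *)
Lemma leading_limit (k : nat) (a : nat -> nat -> C) (r : R) (f : C -> C -> C) (N : nat)
  (zn wn : nat -> C) (z w : C) :
  (1 <= k)%nat -> 0 < r -> expands a r f ->
  (forall m l, (m + k * l < N)%nat -> a m l = 0%C) ->
  C_lim zn z -> C_lim wn w ->
  C_lim (fun n => RtoC (/ tau n ^ N) * f (RtoC (tau n) * zn n) (RtoC (tau n ^ k) * wn n))%C
    (weighted_part k a N z w).
Proof.
  intros Hk Hr Hf Ha Hz Hw.
  destruct (C_lim_bounded _ _ Hz) as (r1 & R1 & B1).
  destruct (C_lim_bounded _ _ Hw) as (r2 & R2 & B2).
  pose proof (expands_lin _ _ (-1)%C _ _ _ Hf (expands_weighted_part k a N r Hk)) as He.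
  destruct (expands_bound k _ r _ (S N) (r1 + r2) Hk Hr He) as (K & d & Hd & HK).
  { intros m l Hml. destruct (Nat.eqb_spec (m + k * l) N); [ring|].
    rewrite Ha by lia. ring. }
  { lra. }
  apply C_lim_Cmod_bound with (v := fun n => weighted_part k a N (zn n) (wn n))
    (e := fun n => K * tau n).
  - destruct B1 as [N1 B1], B2 as [N2 B2].
    destruct (eventually_lt _ _ d tau_lim Hd) as [N3 B3].
    exists (N1 + N2 + N3)%nat; intros n Hn.
    specialize (B1 n ltac:(lia)); specialize (B2 n ltac:(lia)); specialize (B3 n ltac:(lia)).
    specialize (HK (tau n) (zn n) (wn n) (conj (tau_pos n) B3) ltac:(lra) ltac:(lra)).
    rewrite weighted_part_homogeneous in HK.
    pose proof (pow_lt _ N (tau_pos n)) as HT.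
    match goal with |- Cmod ?x <= _ => replace x with (RtoC (/ tau n ^ N) *
      (f (RtoC (tau n) * zn n) (RtoC (tau n ^ k) * wn n)
        + -1 * (RtoC (tau n ^ N) * weighted_part k a N (zn n) (wn n))))%C end.
    + rewrite Cmod_mult, Cmod_R, Rabs_pos_eq.
      * apply Rle_trans with (/ tau n ^ N * (K * tau n ^ S N)).
        -- apply Rmult_le_compat_l; [left; apply Rinv_0_lt_compat|]; assumption.
        -- right; simpl; field; lra.
      * left; apply Rinv_0_lt_compat; assumption.
    + rewrite RtoC_inv by lra. field.
      intro E; apply RtoC_inj in E; lra.
  - replace (Finite 0) with (Finite (K * 0)) by (f_equal; ring).
    apply (is_lim_seq_scal_l tau K 0), tau_lim.
  - unfold weighted_part. apply C_lim_sum; intro l.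
    destruct (Nat.leb (k * l) N); [|apply C_lim_const].
    unfold pterm2.
    apply C_lim_mult; [apply C_lim_mult; [apply C_lim_const|]|]; apply C_lim_pow; assumption.
Qed.

(** * Rigidity of the model hypersurface *)

Lemma C_deriv_pair_l (s u : R) : C_deriv (fun t => (t, s) : C) u 1.
Proof.
  split; [exact (is_derive_id u) | exact (is_derive_const (s : R) u)].
Qed.

(** On the model, [w = u + i c x^k] is stationary at [x = 0]. *)
Lemma C_deriv_base (u c : R) (k : nat) :
  (2 <= k)%nat -> C_deriv (fun t => (u, c * t ^ k) : C) 0 0.
Proof.
  intros Hk; split; [exact (is_derive_const (u : R) 0)|].
  assert (H := is_derive_scal (fun t => t ^ k) 0 c _ (is_derive_pow _ k _ _ (is_derive_id 0))).
  replace (Im 0) with (c * (INR k * one * 0 ^ pred k)); [exact H|].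
  rewrite pow_i by lia. unfold Im; simpl; ring.
Qed.

Lemma C_deriv_Re_const (f : R -> C) (x : R) (l : C) (v : R) :
  C_deriv f x l -> (forall t, Re (f t) = v) -> Re l = 0.
Proof.
  intros [H _] E.
  apply is_derive_unique in H; rewrite <- H.
  rewrite (Derive_ext _ (fun _ => v)) by apply E.
  apply Derive_const.
Qed.

Lemma Re_Im_Ci_0 (v : C) : Re v = 0 -> Re (v * Ci)%C = 0 -> v = 0%C.
Proof.
  intros H1 H2; rewrite Cmult_comm, Re_Ci_mult in H2.
  apply C_ext; simpl; [assumption | unfold Im in *; simpl; lra].
Qed.

Lemma C_deriv_shift_pow (b : C) (s u : R) (m : nat) :
  C_deriv (fun t => b * (t, s) ^ m)%C u (RtoC (INR m) * (b * (u, s) ^ pred m))%C.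
Proof.
  pose proof (C_deriv_mult _ _ _ _ _ (C_deriv_const b u)
    (C_deriv_pow _ _ _ m (C_deriv_pair_l s u))) as H.
  cbv beta in H.
  replace (RtoC (INR m) * (b * (u, s) ^ pred m))%C with
    (0 * (u, s) ^ m + b * (RtoC (INR m) * (u, s) ^ pred m * 1))%C by ring.
  exact H.
Qed.

(** Besides the function itself, its derivative in [u] vanishes; at [u = 0] this gives
    the real and the imaginary part of [b (i s)^(m-1)]. *)
Lemma Re_shift_pow_zero (b : C) (s : R) (m : nat) :
  s <> 0 -> (1 <= m)%nat -> (forall u, Re (b * (u, s) ^ m)%C = 0) -> b = 0%C.
Proof.
  intros Hs Hm H.
  assert (E : ((0, s) : C) = (RtoC s * Ci)%C) by (apply C_ext; unfold Re, Im; simpl; ring).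
  pose proof (C_deriv_Re_const _ _ _ 0 (C_deriv_shift_pow b s 0 m) H) as D.
  specialize (H 0).
  destruct m as [|m]; [lia|]. simpl pred in D.
  rewrite re_scal_l in D.
  apply Rmult_integral in D; destruct D as [D | D].
  { pose proof (lt_0_INR (S m) ltac:(lia)); lra. }
  assert (Z : (b * (0, s) ^ m)%C = 0%C).
  { apply Re_Im_Ci_0; [exact D|].
    apply Rmult_eq_reg_l with s; [|assumption].
    rewrite <- re_scal_l, Rmult_0_r; refine (eq_trans _ H); f_equal.
    rewrite Cpow_S, E; ring. }
  assert (N : ((0, s) ^ m)%C <> 0%C).
  { apply Cpow_nz; intro F; apply Hs; injection F; auto. }
  replace b with ((b * (0, s) ^ m) / (0, s) ^ m)%C by (field; exact N).
  rewrite Z; field; exact N.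
Qed.

Lemma Re_shift_pow_const (b : C) (s v : R) (m : nat) :
  s <> 0 -> (2 <= m)%nat -> (forall u, Re (b * (u, s) ^ m)%C = v) -> b = 0%C.
Proof.
  intros Hs Hm H.
  apply Re_shift_pow_zero with s (pred m); [assumption | lia |].
  intro u.
  pose proof (C_deriv_Re_const _ _ _ v (C_deriv_shift_pow b s u m) H) as D.
  rewrite re_scal_l in D.
  apply Rmult_integral in D; destruct D as [D | D]; [|exact D].
  pose proof (lt_0_INR m ltac:(lia)); lra.
Qed.

Lemma sum_n_recl (e : nat -> R) (N : nat) :
  sum_n e (S N) = e 0%nat + sum_n (fun l => e (S l)) N.
Proof.
  induction N; [rewrite sum_Sn, !sum_O; reflexivity|].
  rewrite sum_Sn, IHN, sum_Sn. unfold plus; simpl; ring.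
Qed.

Lemma poly_zero (N : nat) : forall e : nat -> R,
  (forall u, sum_n (fun l => e l * u ^ l) N = 0) -> forall l, (l <= N)%nat -> e l = 0.
Proof.
  induction N; intros e H.
  - intros l Hl; specialize (H 0); rewrite sum_O in H.
    replace l with 0%nat by lia. simpl in H; lra.
  - assert (E0 : e 0%nat = 0).
    { specialize (H 0); rewrite sum_n_recl in H.
      rewrite (sum_n_ext _ (fun _ => 0)) in H.
      - rewrite sum_n_const in H; simpl in H; lra.
      - intro i; simpl; ring. }
    (* After division by [u], the value at [u = 0] is recovered by continuity. *)
    set (d := fun u => sum_n (fun l => e (S l) * u ^ l) N).
    assert (D : forall u, u <> 0 -> d u = 0).
    { intros u Hu; apply Rmult_eq_reg_l with u; [|assumption].
      rewrite Rmult_0_r; refine (eq_trans _ (H u)); rewrite sum_n_recl, E0. unfold d.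
      change (u * ?s) with (mult (K := R_Ring) u s).
      rewrite <- (sum_n_mult_l (K := R_Ring)), Rmult_0_l, Rplus_0_l.
      apply sum_n_ext; intro l; unfold mult; simpl; ring. }
    assert (D0 : d 0 = 0).
    { assert (L : is_lim_seq (fun n => d (tau n)) (d 0)).
      { unfold d; clear; induction N.
        - apply is_lim_seq_ext with (fun n => e 1%nat * tau n ^ 0);
            [intro n; rewrite sum_O; reflexivity|].
          rewrite sum_O; simpl; apply is_lim_seq_const.
        - apply is_lim_seq_ext with (fun n => sum_n (fun l => e (S l) * tau n ^ l) N
            + e (S (S N)) * tau n ^ S N); [intro n; rewrite sum_Sn; reflexivity|].
          rewrite sum_Sn; apply is_lim_seq_plus'; [exact IHN|].
          apply is_lim_seq_mult'; [apply is_lim_seq_const|].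
          apply is_lim_seq_pow, tau_lim. }
    assert (L0 : is_lim_seq (fun n => d (tau n)) 0).
      { eapply is_lim_seq_ext; [|apply is_lim_seq_const].
        intro n; symmetry; apply D; pose proof (tau_pos n); lra. }
      exact (is_lim_seq_unique_R _ _ _ L L0). }
    intros [|l] Hl; [exact E0|].
    apply (IHN (fun l => e (S l))); [|lia].
    intro u; destruct (Req_dec u 0) as [->|Hu]; [exact D0 | exact (D u Hu)].
Qed.

Lemma weighted_part_single (k : nat) (a : nat -> nat -> C) (N m0 l0 : nat) (z w : C) :
  (1 <= k)%nat -> (m0 + k * l0 = N)%nat ->
  (forall m l, (m + k * l = N)%nat -> l <> l0 -> a m l = 0%C) ->
  weighted_part k a N z w = (a m0 l0 * z ^ m0 * w ^ l0)%C.
Proof.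
  intros Hk E H; unfold weighted_part.
  rewrite (sum_n_ext_loc (G := C_AbelianMonoid) _ (fun l => if Nat.eqb l l0 then
    pterm2 a z w m0 l0 else zero)).
  - rewrite (sum_n_single (V := C_AbelianMonoid)).
    destruct (Nat.leb_spec l0 N); [reflexivity | nia].
  - intros l Hl.
    destruct (Nat.eqb_spec l l0) as [-> | Hn].
    + destruct (Nat.leb_spec (k * l0) N); [|lia].
      replace (N - k * l0)%nat with m0 by lia; reflexivity.
    + destruct (Nat.leb_spec (k * l) N); [|reflexivity].
      unfold pterm2; rewrite (H (N - k * l)%nat l) by lia.
      change (@zero C_AbelianMonoid) with (RtoC 0).
      match goal with |- ?x = ?y => change (@eq C x y) end; ring.
Qed.

Lemma weighted_part_ext (k : nat) (a b : nat -> nat -> C) (N : nat) (z w z' : C) :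
  (forall m l, (m + k * l = N)%nat -> (a m l * z ^ m = b m l * z' ^ m)%C) ->
  weighted_part k a N z w = weighted_part k b N z' w.
Proof.
  intros H; unfold weighted_part; apply sum_n_ext; intro l.
  destruct (Nat.leb_spec (k * l) N); [|reflexivity].
  unfold pterm2; rewrite H by lia; reflexivity.
Qed.

Lemma weighted_part_zero (k : nat) (N : nat) (z w : C) :
  weighted_part k (fun _ _ => 0%C) N z w = 0%C.
Proof.
  unfold weighted_part; rewrite (sum_n_ext (G := C_AbelianMonoid) _ (fun _ => zero)).
  - induction N; [rewrite sum_O; reflexivity|].
    rewrite sum_Sn, IHN. apply (plus_zero_l (G := C_AbelianMonoid)).
  - intro l; destruct (Nat.leb (k * l) N); [|reflexivity].
    unfold pterm2. change (@zero C_AbelianMonoid) with (RtoC 0).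
    match goal with |- ?x = ?y => change (@eq C x y) end; ring.
Qed.

Lemma weighted_part_scal (k : nat) (a : nat -> nat -> C) (c : C) (N : nat) (z w : C) :
  weighted_part k (fun m l => c * a m l)%C N z w = (c * weighted_part k a N z w)%C.
Proof.
  unfold weighted_part. change (c * ?s)%C with (mult (K := C_Ring) c s).
  rewrite <- (sum_n_mult_l (K := C_Ring)); apply sum_n_ext; intro l.
  change (@mult C_Ring) with Cmult.
  match goal with |- ?x = ?y => change (@eq C x y) end.
  destruct (Nat.leb (k * l) N); unfold pterm2; ring.
Qed.

Lemma weighted_part_origin (k : nat) (a : nat -> nat -> C) (N : nat) :
  (1 <= N)%nat -> weighted_part k a N 0 0 = 0%C.
Proof.
  intros HN; transitivity (weighted_part k (fun _ _ => 0%C) N 0 0); [|apply weighted_part_zero].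
  unfold weighted_part; apply sum_n_ext; intro l.
  destruct (Nat.leb_spec (k * l) N); [|reflexivity].
  assert (P : forall n, (1 <= n)%nat -> (RtoC 0 ^ n)%C = RtoC 0)
    by (intros [|n] Hn; [lia | simpl; ring]).
  unfold pterm2; cbv beta.
  match goal with |- ?x = ?y => change (@eq C x y) end.
  destruct l as [|l].
  - rewrite (P (N - k * 0)%nat) by lia; ring.
  - rewrite (P (S l)) by lia; ring.
Qed.

Lemma weighted_part_real_w (k : nat) (a : nat -> nat -> C) (N : nat) (z : C) (u : R) :
  Re (weighted_part k a N z (RtoC u)) = sum_n (fun l =>
    (if Nat.leb (k * l) N then Re (a (N - k * l)%nat l * z ^ (N - k * l))%C else 0) * u ^ l) N.
Proof.
  unfold weighted_part; rewrite Re_sum_n; apply sum_n_ext; intro l.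
  match goal with |- ?x = ?y => change (@eq R x y) end.
  destruct (Nat.leb (k * l) N).
  - unfold pterm2; rewrite <- RtoC_pow, re_scal_r; reflexivity.
  - simpl; ring.
Qed.

(** On the line [x = 0] of the model [w] is real, and a weighted homogeneous polynomial
    restricted to fixed [z] and real [w] is a polynomial in [u] whose coefficients are
    read off one by one. *)
Lemma weighted_part_real_w_coef (k : nat) (a b : nat -> nat -> C) (N : nat) (z z' : C) :
  (1 <= k)%nat ->
  (forall u, Re (weighted_part k a N z (RtoC u)) = Re (weighted_part k b N z' (RtoC u))) ->
  forall m l, (m + k * l = N)%nat -> Re (a m l * z ^ m)%C = Re (b m l * z' ^ m)%C.
Proof.
  intros Hk H m l E.
  pose proof (poly_zero N (fun l =>
    (if Nat.leb (k * l) N then Re (a (N - k * l)%nat l * z ^ (N - k * l))%C else 0) -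
    (if Nat.leb (k * l) N then Re (b (N - k * l)%nat l * z' ^ (N - k * l))%C else 0))) as P.
  cbv beta in P.
  assert (Q : forall u, sum_n (fun l =>
    ((if Nat.leb (k * l) N then Re (a (N - k * l)%nat l * z ^ (N - k * l))%C else 0) -
    (if Nat.leb (k * l) N then Re (b (N - k * l)%nat l * z' ^ (N - k * l))%C else 0)) * u ^ l) N
      = 0).
  { intro u. specialize (H u). rewrite !weighted_part_real_w in H.
    revert H. match goal with |- sum_n ?f _ = sum_n ?g _ -> _ =>
      assert (S : forall n, sum_n (fun l => f l - g l) n = sum_n f n - sum_n g n) end.
    { induction n; rewrite ?sum_O, ?sum_Sn; [reflexivity|].
      rewrite IHn; unfold plus; simpl; ring. }
    intro H. specialize (S N). rewrite H, Rminus_diag_eq in S by reflexivity.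
    refine (eq_trans _ S); apply sum_n_ext; intro i. simpl; ring. }
  specialize (P Q l ltac:(nia)).
  destruct (Nat.leb_spec (k * l) N); [|lia].
  replace (N - k * l)%nat with m in P by lia. lra.
Qed.

(** The coefficients of the derivative in [z]. *)
Definition dz_coef (a : nat -> nat -> C) (m l : nat) : C := (RtoC (INR (S m)) * a (S m) l)%C.

Lemma C_deriv_weighted_part (k : nat) (a : nat -> nat -> C) (M : nat) (y u c : R) :
  (2 <= k)%nat ->
  C_deriv (fun x => weighted_part k a (S M) (x, y) (u, c * x ^ k)) 0
    (weighted_part k (dz_coef a) M (0, y) (RtoC u)).
Proof.
  intros Hk.
  set (D := fun l => if Nat.leb (k * l) (S M) then
    (a (S M - k * l)%nat l * (RtoC (INR (S M - k * l)) * (0, y) ^ pred (S M - k * l)) *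
      RtoC u ^ l)%C else RtoC 0).
  replace (weighted_part k (dz_coef a) M (0, y) (RtoC u)) with (sum_n D (S M) : C).
  - unfold weighted_part. apply C_deriv_sum; intro l; unfold D.
    destruct (Nat.leb_spec (k * l) (S M)); [|apply C_deriv_const].
    unfold pterm2.
    pose proof (C_deriv_mult _ _ _ _ _
      (C_deriv_mult _ _ _ _ _ (C_deriv_const (a (S M - k * l)%nat l) 0)
        (C_deriv_pow _ _ _ (S M - k * l) (C_deriv_pair_l y 0)))
      (C_deriv_pow _ _ _ l (C_deriv_base u c k Hk))) as H0.
    cbv beta in H0. rewrite pow_i, Rmult_0_r in H0 by lia.
    change ((u, 0) : C) with (RtoC u) in H0.
    match type of H0 with C_deriv _ _ ?v => match goal with |- C_deriv _ _ ?v' =>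
      replace v' with v by ring end end.
    exact H0.
  - rewrite sum_Sn. unfold D at 2.
    destruct (Nat.leb_spec (k * S M) (S M)); [nia|].
    change (RtoC 0) with (@zero C_AbelianMonoid); rewrite plus_zero_r.
    unfold weighted_part; apply (sum_n_ext_loc (G := C_AbelianMonoid)); intros l Hl; unfold D.
    match goal with |- ?x = ?y => change (@eq C x y) end.
    destruct (Nat.leb_spec (k * l) (S M)), (Nat.leb_spec (k * l) M); try lia; try reflexivity.
    + replace (S M - k * l)%nat with (S (M - k * l)) by lia.
      unfold pterm2, dz_coef; simpl pred. ring.
    + replace (S M - k * l)%nat with 0%nat by lia. simpl INR; ring.
Qed.

(** Used to extend an identity which was divided by a power of [x] to the line [x = 0],
    together with its first derivative. *)
Lemma is_derive_punctured_zero (d : R -> R) (l : R) :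
  is_derive d 0 l -> (forall x, x <> 0 -> d x = 0) -> d 0 = 0 /\ l = 0.
Proof.
  intros H E.
  assert (E0 : d 0 = 0).
  { assert (L : is_lim_seq (fun n => d (tau n)) (d 0)).
    { apply is_lim_seq_continuous; [|apply tau_lim].
      apply continuity_pt_filterlim, (ex_derive_continuous (V := R_NormedModule)).
      exists l; exact H. }
    assert (L0 : is_lim_seq (fun n => d (tau n)) 0).
    { eapply is_lim_seq_ext; [|apply is_lim_seq_const].
      intro n; symmetry; apply E; pose proof (tau_pos n); lra. }
    exact (is_lim_seq_unique_R _ _ _ L L0). }
  split; [exact E0|].
  apply is_derive_unique in H; rewrite <- H, (Derive_ext _ (fun _ => 0)).
  - apply Derive_const.
  - intro x; destruct (Req_dec x 0) as [-> | Hx]; auto.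
Qed.

Lemma Re_mult_real_0 (r : R) (v : C) : r <> 0 -> Re (RtoC r * v)%C = 0 -> Re v = 0.
Proof. intros Hr H; rewrite re_scal_l in H; apply Rmult_integral in H; tauto. Qed.

Lemma Im_as_Re (v : C) : Im v = Re (- Ci * v)%C.
Proof. unfold Im, Re, Ci; simpl; ring. Qed.

Lemma weighted_part_real_w_Im_zero (k : nat) (b : nat -> nat -> C) (N : nat) (z : C) :
  (1 <= k)%nat ->
  (forall u, Im (weighted_part k b N z (RtoC u)) = 0) ->
  forall m l, (m + k * l = N)%nat -> Im (b m l * z ^ m)%C = 0.
Proof.
  intros Hk H m l E.
  rewrite Im_as_Re, Cmult_assoc.
  pose proof (weighted_part_real_w_coef k (fun m l => - Ci * b m l)%C
    (fun _ _ => RtoC 0) N z z Hk) as L.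
  cbv beta in L; rewrite L with (2 := E).
  - rewrite Cmult_0_l; reflexivity.
  - intro u. rewrite weighted_part_scal, <- Im_as_Re, H, weighted_part_zero; reflexivity.
Qed.

Lemma Im_Ci_pow_0 (v : C) (m : nat) :
  Im (v * Ci ^ m)%C = 0 -> Im (v * Ci ^ S m)%C = 0 -> v = 0%C.
Proof.
  intros H1 H2.
  assert (Z : (v * Ci ^ m)%C = 0%C).
  { apply C_ext; [|exact H1].
    rewrite <- Im_Ci_mult; refine (eq_trans _ H2); f_equal; simpl; ring. }
  assert (N : (Ci ^ m)%C <> 0%C).
  { apply Cpow_nz; intro F; injection F; intros; lra. }
  replace v with ((v * Ci ^ m) / Ci ^ m)%C by (field; exact N).
  rewrite Z; field; exact N.
Qed.

Lemma Re_Ci_pow_0 (v : C) (m : nat) :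
  Re (v * Ci ^ m)%C = 0 -> Re (v * Ci ^ S m)%C = 0 -> v = 0%C.
Proof.
  intros H1 H2.
  apply Im_Ci_pow_0 with (S m).
  - rewrite Im_as_Re.
    transitivity (Re (v * Ci ^ m)%C); [f_equal | exact H1].
    rewrite Cpow_S. transitivity (- (Ci * Ci) * (v * Ci ^ m))%C; [ring|].
    replace (Ci * Ci)%C with (RtoC (-1)) by (apply C_ext; unfold Re, Im; simpl; ring).
    apply C_ext; unfold Re, Im; simpl; ring.
  - rewrite Im_as_Re.
    transitivity (Re (v * Ci ^ S m)%C); [f_equal | exact H2].
    rewrite (Cpow_S Ci (S m)). transitivity (- (Ci * Ci) * (v * Ci ^ S m))%C; [ring|].
    replace (Ci * Ci)%C with (RtoC (-1)) by (apply C_ext; unfold Re, Im; simpl; ring).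
    ring.
Qed.

(** The term with [Re] carries the factor [x^(k-1)], so that it affects neither the
    value nor the first derivative at [x = 0] because [k >= 3].  The value and the
    derivative of [Im] of the polynomial are therefore constant on that line, which gives two
    conditions that determine the real and imaginary part of each coefficient of a
    monomial divisible by [z]. *)
Lemma model_g_z_free (k N : nat) (c A : R) (a b : nat -> nat -> C) (M : nat) :
  (3 <= k)%nat -> (1 <= M)%nat ->
  (forall x y u y' u',
    Im (weighted_part k b (S M) (x, y) (u, c * x ^ k)) -
      A * x ^ (k - 1) * Re (weighted_part k a N (x, y) (u, c * x ^ k)) =
    Im (weighted_part k b (S M) (x, y') (u', c * x ^ k)) -
      A * x ^ (k - 1) * Re (weighted_part k a N (x, y') (u', c * x ^ k))) ->
  forall m l, (m + k * l = S M)%nat -> (1 <= m)%nat -> b m l = 0%C.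
Proof.
  intros Hk HM H m l E Hm.
  (* Equality with the value at [y = u = 0], where every monomial vanishes. *)
  assert (V : forall y u, Im (weighted_part k b (S M) (0, y) (RtoC u)) = 0).
  { intros y u. specialize (H 0 y u 0 0).
    rewrite (pow_i (k - 1)), (pow_i k), !Rmult_0_r, !Rmult_0_l in H by lia.
    change ((0, 0) : C) with (RtoC 0) in H. rewrite weighted_part_origin in H by lia.
    change ((u, 0) : C) with (RtoC u) in H. simpl Im in H at 2. lra. }
  assert (W : forall y u, is_derive (fun x => Im (weighted_part k b (S M) (x, y) (u, c * x ^ k)) -
      A * x ^ (k - 1) * Re (weighted_part k a N (x, y) (u, c * x ^ k))) 0
      (Im (weighted_part k (dz_coef b) M (0, y) (RtoC u)))).
  { intros y u.
    destruct (C_deriv_weighted_part k b M y u c ltac:(lia)) as [_ H1].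
    assert (Hp : exists l, is_derive (fun x => Re (weighted_part k a N (x, y) (u, c * x ^ k))) 0 l).
    { destruct N as [|N].
      - exists 0. apply is_derive_ext with (fun _ => Re (a 0%nat 0%nat)).
        + intro t. rewrite (weighted_part_single k a 0 0 0); [|lia|lia|intros; nia].
          apply f_equal; simpl; ring.
        + exact (is_derive_const (Re (a 0%nat 0%nat)) 0).
      - destruct (C_deriv_weighted_part k a N y u c ltac:(lia)) as [H2 _]. eexists; exact H2. }
    destruct Hp as [p Hp].
    pose proof (is_derive_scal (fun t => t ^ (k - 1)) 0 A _
      (is_derive_pow _ (k - 1) _ _ (is_derive_id 0))) as H3.
    pose proof (is_derive_minus _ _ _ _ _ H1 (is_derive_mult _ _ _ _ _ H3 Hp Rmult_comm)) as H4.
    match type of H4 with is_derive _ _ ?v => match goal with |- is_derive _ _ ?v' =>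
      replace v' with v end end.
    - exact H4.
    - rewrite (pow_i (pred (k - 1))), (pow_i (k - 1)) by lia.
      unfold minus, plus, opp, mult, scal; simpl; unfold mult; simpl. ring. }
  assert (D : forall y u, Im (weighted_part k (dz_coef b) M (0, y) (RtoC u)) = 0).
  { intros y u.
    transitivity (Im (weighted_part k (dz_coef b) M (0, 0) (RtoC 0))).
    - pose proof (is_derive_unique _ _ _ (W y u)) as D1.
      pose proof (is_derive_unique _ _ _ (W 0 0)) as D2.
      rewrite <- D1, <- D2. apply Derive_ext; intro t; apply H.
    - change ((0, 0) : C) with (RtoC 0). rewrite weighted_part_origin by lia. reflexivity. }
  destruct m as [|m]; [lia|].
  apply Im_Ci_pow_0 with m.
  - pose proof (weighted_part_real_w_Im_zero k (dz_coef b) M Ci ltac:(lia) (D 1) m l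
      ltac:(lia)) as Q.
    unfold dz_coef in Q. rewrite <- Cmult_assoc, Im_scal in Q.
    apply Rmult_integral in Q; destruct Q as [Q | Q]; [|exact Q].
    pose proof (lt_0_INR (S m) ltac:(lia)); lra.
  - exact (weighted_part_real_w_Im_zero k b (S M) Ci ltac:(lia) (V 1) (S m) l E).
Qed.

(** The restriction to [x = 0] and the first derivative in [x] there give two real
    conditions on each coefficient.  For a monomial of degree 1 in [z] the
    derivative does not depend on [y] and one of them is lost, whence [2 <= m]. *)
Lemma y_independent_coef (k : nat) (c : R) (a : nat -> nat -> C) (M : nat) :
  (2 <= k)%nat ->
  (forall x y u, x <> 0 ->
    Re (weighted_part k a (S M) (x, y) (u, c * x ^ k)) =
      Re (weighted_part k a (S M) (x, 0) (u, c * x ^ k))) ->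
  forall m l, (m + k * l = S M)%nat -> (2 <= m)%nat -> a m l = 0%C.
Proof.
  intros Hk H m l E Hm.
  assert (P : forall u,
    Re (weighted_part k a (S M) Ci (RtoC u)) = Re (weighted_part k a (S M) (RtoC 0) (RtoC u)) /\
    Re (weighted_part k (dz_coef a) M Ci (RtoC u)) =
      Re (weighted_part k (dz_coef a) M (RtoC 0) (RtoC u))).
  { intro u.
    destruct (C_deriv_weighted_part k a M 1 u c Hk) as [H1 _].
    destruct (C_deriv_weighted_part k a M 0 u c Hk) as [H2 _].
    destruct (is_derive_punctured_zero _ _ (is_derive_minus _ _ _ _ _ H1 H2)) as [Q1 Q2].
    - intros x Hx; cbv beta. rewrite H by assumption.
      apply (minus_eq_zero (G := R_AbelianGroup)).
    - cbv beta in Q1. change (minus ?v ?v') with (v - v') in Q1, Q2.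
      rewrite pow_i, Rmult_0_r in Q1 by lia.
      change ((u, 0) : C) with (RtoC u) in Q1.
      change ((0, 0) : C) with (RtoC 0) in Q1, Q2.
      change ((0, 1) : C) with Ci in Q1, Q2.
      split; lra. }
  assert (Z : forall n, (1 <= n)%nat -> (RtoC 0 ^ n)%C = RtoC 0)
    by (intros [|n] Hn; [lia | simpl; ring]).
  destruct m as [|m]; [lia|].
  apply Re_Ci_pow_0 with m.
  - pose proof (weighted_part_real_w_coef k (dz_coef a) (dz_coef a) M Ci (RtoC 0) ltac:(lia)
      (fun u => proj2 (P u)) m l ltac:(lia)) as Q.
    rewrite Z, Cmult_0_r in Q by lia.
    unfold dz_coef in Q. rewrite <- Cmult_assoc in Q.
    apply Re_mult_real_0 in Q; [exact Q|].
    pose proof (lt_0_INR (S m) ltac:(lia)); lra.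
  - pose proof (weighted_part_real_w_coef k a a (S M) Ci (RtoC 0) ltac:(lia)
      (fun u => proj1 (P u)) (S m) l E) as Q.
    rewrite Q, Z, Cmult_0_r by lia. reflexivity.
Qed.

(** The polynomial with coefficients [b] is free of [z] by [model_g_z_free].  Comparing two
    values of [y] with the same [x] and [u] then cancels it, and the real part of the
    polynomial with coefficients [a] is independent of [y].  This leaves a single monomial
    [z w^l] or [w^l] of weight [1 + j]; the first is excluded by independence of [y], the
    second by independence of [u], except for [i w] times a real number: that is the term
    [i be w] of the theorem, and the last hypothesis removes it.  The two polynomials
    cannot both be powers of [w], since their weights differ by [k - 1]. *)
Lemma model_rigidity (k j : nat) (c A : R) (a b : nat -> nat -> C) :
  (3 <= k)%nat -> c <> 0 -> A <> 0 -> (1 <= j)%nat ->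
  (forall x y u y' u',
    Im (weighted_part k b (k + j) (x, y) (u, c * x ^ k)) -
      A * x ^ (k - 1) * Re (weighted_part k a (1 + j) (x, y) (u, c * x ^ k)) =
    Im (weighted_part k b (k + j) (x, y') (u', c * x ^ k)) -
      A * x ^ (k - 1) * Re (weighted_part k a (1 + j) (x, y') (u', c * x ^ k))) ->
  ((1 + j)%nat = k -> Im (a 0%nat 1%nat) = 0) ->
  (forall m l, (m + k * l = 1 + j)%nat -> a m l = 0%C) /\
  (forall m l, (m + k * l = k + j)%nat -> b m l = 0%C).
Proof.
  intros Hk Hc HA Hj H Ha.
  assert (B : forall m l, (m + k * l = k + j)%nat -> (1 <= m)%nat -> b m l = 0%C).
  { replace (k + j)%nat with (S (k + j - 1)) in H |- * by lia.
    exact (model_g_z_free k (1 + j) c A a b (k + j - 1) Hk ltac:(lia) H). }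
  assert (Y : forall x y u, x <> 0 ->
    Re (weighted_part k a (1 + j) (x, y) (u, c * x ^ k)) =
      Re (weighted_part k a (1 + j) (x, 0) (u, c * x ^ k))).
  { intros x y u Hx. specialize (H x y u 0 u).
    rewrite (weighted_part_ext k b b _ (x, y) _ (x, 0)) in H.
    - apply Rmult_eq_reg_l with (A * x ^ (k - 1)); [lra|].
      apply Rmult_integral_contrapositive; split; [assumption|].
      apply pow_nonzero; assumption.
    - intros m l E. destruct m as [|m]; [simpl; ring|].
      rewrite B by lia. ring. }
  assert (A2 : forall m l, (m + k * l = 1 + j)%nat -> (2 <= m)%nat -> a m l = 0%C).
  { exact (y_independent_coef k c a j ltac:(lia) Y). }
  (* For a monomial [a z w^l], the difference between [y = 1] and [y = 0] is
     [Re (i a w^l)]. *)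
  assert (A1 : forall l, (1 + k * l = 1 + j)%nat -> a 1%nat l = 0%C).
  { intros l E.
    assert (S1 : forall z w, weighted_part k a (1 + j) z w = (a 1%nat l * z ^ 1 * w ^ l)%C).
    { intros z w; apply weighted_part_single; [lia | exact E |].
      intros m l' E' Hn. apply A2; [exact E'|].
      destruct m as [|[|m]]; [exfalso | exfalso | lia].
      - assert (k * l' = 1 + k * l)%nat by lia.
        assert (l < l')%nat by nia. nia.
      - apply Hn. assert (k * l' = k * l)%nat by lia. nia. }
    assert (Z : (a 1%nat l * Ci)%C = 0%C).
    { apply Re_shift_pow_zero with c l; [assumption | destruct l; lia |].
      intro u. specialize (Y 1 1 u ltac:(lra)).
      rewrite !S1, pow1, Rmult_1_r, !Cpow_1_r in Y.
      replace (a 1%nat l * Ci * (u, c) ^ l)%C with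
        (a 1%nat l * (1, 1) * (u, c) ^ l - a 1%nat l * (1, 0) * (u, c) ^ l)%C.
      - rewrite Re_minus; lra.
      - replace ((1, 1) : C) with (1 + Ci)%C by (apply C_ext; unfold Re, Im; simpl; ring).
        change ((1, 0) : C) with (RtoC 1). ring. }
    apply Re_Im_Ci_0; [|rewrite Z; reflexivity].
    rewrite <- Im_Ci_mult, Cmult_comm, Z; reflexivity. }
  assert (A0 : forall l, (k * l = 1 + j)%nat -> a 0%nat l = 0%C).
  { intros l E.
    assert (S0 : forall z w, weighted_part k a (1 + j) z w = (a 0%nat l * w ^ l)%C).
    { intros z w. rewrite (weighted_part_single k a (1 + j) 0 l); [simpl; ring | lia | lia |].
      intros m l' E' Hn. destruct m as [|[|m]].
      - exfalso; apply Hn; nia.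
      - apply A1; lia.
      - apply A2; lia. }
    (* Both [k l = 1 + j] and [k l' = k + j] would make [k - 1] a multiple of [k]. *)
    assert (B0 : forall m l, (m + k * l = k + j)%nat -> b m l = 0%C).
    { intros m l' E'. apply B; [exact E'|]. destruct m; [exfalso | lia].
      assert (k * l' = k * l + (k - 1))%nat by lia.
      assert (l < l')%nat by nia. nia. }
    assert (K : forall u, Re (a 0%nat l * (u, c) ^ l)%C = Re (a 0%nat l * (0, c) ^ l)%C).
    { intro u. specialize (H 1 0 u 0 0).
      rewrite !S0, !pow1, !Rmult_1_r in H.
      rewrite !(weighted_part_ext k b (fun _ _ => RtoC 0) (k + j) (1, 0) _ (RtoC 0)),
        !weighted_part_zero in H.
      - apply Rmult_eq_reg_l with A; [lra | assumption].
      - intros m l' E'. rewrite B0 by assumption; ring.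
      - intros m l' E'. rewrite B0 by assumption; ring. }
    destruct (Nat.eq_dec l 1) as [-> | Hl].
    - apply C_ext; [|apply Ha; lia].
      specialize (K 1). rewrite !Cpow_1_r, !re_mult in K.
      unfold Re, Im in *; simpl in *; lra.
    - apply Re_shift_pow_const with c (Re (a 0%nat l * (0, c) ^ l)%C) l; auto.
      destruct l as [|[|l]]; lia. }
  assert (Aall : forall m l, (m + k * l = 1 + j)%nat -> a m l = 0%C).
  { intros [|[|m]] l E; [apply A0 | apply A1 | apply A2]; lia. }
  split; [exact Aall|].
  intros m l E. destruct m as [|m]; [|apply B; lia].
  assert (S0 : forall z w, weighted_part k b (k + j) z w = (b 0%nat l * w ^ l)%C).
  { intros z w. rewrite (weighted_part_single k b (k + j) 0 l); [simpl; ring | lia | lia |].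
    intros m l' E' Hn. destruct m as [|m].
    - exfalso; apply Hn; nia.
    - apply B; lia. }
  assert (Z : (- Ci * b 0%nat l)%C = 0%C).
  { apply Re_shift_pow_const with c (Im (b 0%nat l * (0, c) ^ l)%C) l; [assumption | |].
    - destruct l as [|[|l]]; lia.
    - intro u. rewrite <- Cmult_assoc, <- Im_as_Re.
      specialize (H 1 0 u 0 0).
      rewrite !S0, !pow1, !Rmult_1_r in H.
      rewrite !(weighted_part_ext k a (fun _ _ => RtoC 0) (1 + j) (1, 0) _ (RtoC 0)),
        !weighted_part_zero in H.
      + lra.
      + intros m l' E'. rewrite Aall by assumption; ring.
      + intros m l' E'. rewrite Aall by assumption; ring. }
  replace (b 0%nat l) with (Ci * (- Ci * b 0%nat l))%C.
  - rewrite Z; ring.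
  - apply C_ext; unfold Re, Im, Ci; simpl; ring.
Qed.

(** * Analytic functions of finite type on the line *)

Definition power_leading (k : nat) (c : R) (G : R -> R) : Prop :=
  is_domin (locally 0) (fun x : R => x ^ k) (fun x : R => G x - c * x ^ k).

Lemma ratio_lim_to_0 (X : nat -> R) (X0 : R) :
  is_lim_seq (fun n => X n / tau n) X0 -> is_lim_seq X 0.
Proof.
  intros H. apply is_lim_seq_ext with (fun n => X n / tau n * tau n).
  - intro n; field; pose proof (tau_pos n); lra.
  - replace 0 with (X0 * 0) by ring. apply is_lim_seq_mult'; [exact H | exact tau_lim].
Qed.

Lemma eventually_locally_0 (P : R -> Prop) (X : nat -> R) :
  locally 0 P -> is_lim_seq X 0 -> eventually (fun n => P (X n)).
Proof. intros HP HX; exact (HX P HP). Qed.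

Lemma power_leading_limit (k : nat) (c : R) (G : R -> R) (X : nat -> R) (X0 : R) :
  power_leading k c G -> is_lim_seq (fun n => X n / tau n) X0 ->
  is_lim_seq (fun n => G (X n) / tau n ^ k) (c * X0 ^ k).
Proof.
  intros H HX.
  pose proof (ratio_lim_to_0 X X0 HX) as HX0.
  pose proof (is_lim_seq_pow _ _ k HX) as HP.
  assert (Z : is_lim_seq (fun n => (G (X n) - c * X n ^ k) / tau n ^ k) 0).
  { apply is_lim_seq_spec; intro eps.
    set (B := Rabs (X0 ^ k) + 1).
    assert (HB : 0 < B) by (pose proof (Rabs_pos (X0 ^ k)); unfold B; lra).
    assert (He : 0 < eps / B / 2).
    { pose proof (cond_pos eps). apply Rdiv_lt_0_compat; [apply Rdiv_lt_0_compat|]; lra. }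
    pose proof (eventually_locally_0 _ _ (H (mkposreal _ He)) HX0) as E1.
    pose proof (eventually_lt _ _ B (is_lim_seq_abs _ _ HP)
      ltac:(simpl; unfold B; lra)) as E2.
    destruct E1 as [N1 E1], E2 as [N2 E2]; exists (N1 + N2)%nat; intros n Hn.
    specialize (E1 n ltac:(lia)); specialize (E2 n ltac:(lia)).
    change (Rabs (G (X n) - c * X n ^ k) <= eps / B / 2 * Rabs (X n ^ k)) in E1.
    pose proof (pow_lt _ k (tau_pos n)) as Ht.
    rewrite Rminus_0_r. unfold Rdiv at 1; rewrite Rabs_mult, (Rabs_pos_eq (/ _))
      by (left; apply Rinv_0_lt_compat; exact Ht).
    apply Rle_lt_trans with (eps / B / 2 * Rabs ((X n / tau n) ^ k)).
    - replace (Rabs ((X n / tau n) ^ k)) with (Rabs (X n ^ k) * / tau n ^ k).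
      + rewrite <- Rmult_assoc. apply Rmult_le_compat_r; [|exact E1].
        left; apply Rinv_0_lt_compat; exact Ht.
      + unfold Rdiv; rewrite Rpow_mult_distr, Rabs_mult, pow_inv, (Rabs_pos_eq (/ _));
          [reflexivity | left; apply Rinv_0_lt_compat; exact Ht].
    - apply Rle_lt_trans with (eps / B / 2 * B).
      + apply Rmult_le_compat_l; lra.
      + pose proof (cond_pos eps). replace (eps / B / 2 * B) with (eps / 2) by (field; lra). lra. }
  apply is_lim_seq_ext with (fun n => (G (X n) - c * X n ^ k) / tau n ^ k + c * (X n / tau n) ^ k).
  - intro n. unfold Rdiv; rewrite Rpow_mult_distr, pow_inv. ring.
  - replace (c * X0 ^ k) with (0 + c * X0 ^ k) by ring.
    apply is_lim_seq_plus'; [exact Z|].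
    apply is_lim_seq_mult'; [apply is_lim_seq_const | exact HP].
Qed.

Lemma tau_ratio_lim (x : R) : is_lim_seq (fun n => tau n * x / tau n) x.
Proof.
  apply is_lim_seq_ext with (fun _ => x); [|apply is_lim_seq_const].
  intro n; field; pose proof (tau_pos n); lra.
Qed.

Lemma tau_pow_lim (n : nat) : (1 <= n)%nat -> is_lim_seq (fun i => tau i ^ n) 0.
Proof.
  intros Hn; pose proof (is_lim_seq_pow _ _ n tau_lim) as H.
  rewrite pow_i in H by lia; exact H.
Qed.

Lemma inside_CV_radius (a : nat -> R) :
  Rbar_lt 0 (CV_radius a) -> locally 0 (fun x => Rbar_lt (Rabs x) (CV_radius a)).
Proof.
  intros H.
  assert (E : exists rho, 0 < rho /\ Rbar_le rho (CV_radius a)).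
  { destruct (CV_radius a) as [r | |]; [exists r | exists 1 | contradiction];
      (split; [try exact H; lra | simpl; auto; lra]). }
  destruct E as (rho & Hr & Hle).
  exists (mkposreal rho Hr); intros x Hx.
  apply Rbar_lt_le_trans with (2 := Hle).
  change (Rabs (x - 0) < rho) in Hx; rewrite Rminus_0_r in Hx; exact Hx.
Qed.

Lemma PSeries_tau_lim (a : nat -> R) :
  Rbar_lt 0 (CV_radius a) -> is_lim_seq (fun n => PSeries a (tau n)) (PSeries a 0).
Proof.
  intros H; apply is_lim_seq_continuous; [|exact tau_lim].
  apply PSeries_continuity; rewrite Rabs_R0; exact H.
Qed.

(** Comparison with [x^n] for [n < k] shows that the power series of [G] has no terms
    below degree [k]. *)
Lemma power_leading_factor (k : nat) (c : R) (G : R -> R) :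
  real_analytic_at G 0 -> power_leading k c G ->
  exists h, Rbar_lt 0 (CV_radius h) /\ PSeries h 0 = c /\
    locally 0 (fun x => G x = x ^ k * PSeries h x).
Proof.
  intros (a & r & Hr & Ha) Hft.
  assert (Lk : is_lim_seq (fun n => G (tau n) / tau n ^ k) c).
  { replace c with (c * 1 ^ k) by (rewrite pow1; ring).
    apply (power_leading_limit k c G tau 1 Hft).
    apply is_lim_seq_ext with (2 := tau_ratio_lim 1); intro n; rewrite Rmult_1_r; reflexivity. }
  assert (P : forall n, (n <= k)%nat -> exists h, Rbar_lt 0 (CV_radius h) /\
    locally 0 (fun x => G x = x ^ n * PSeries h x)).
  { induction n; intros Hn.
    - exists a; split.
      + apply Rbar_lt_le_trans with (r / 2); [simpl; lra|].
        apply Rbar_not_lt_le; intro L.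
        apply (CV_disk_outside a (r / 2)).
        * rewrite Rabs_pos_eq by lra; exact L.
        * assert (Hx : Rabs (r / 2 - 0) < r) by (rewrite Rminus_0_r, Rabs_pos_eq; lra).
          specialize (Ha _ Hx). rewrite Rminus_0_r in Ha.
          apply is_pseries_R in Ha.
          apply ex_series_lim_0. exists (G (r / 2)); exact Ha.
      + exists (mkposreal r Hr); intros x Hx.
        change (Rabs (x - 0) < r) in Hx.
        specialize (Ha x Hx). rewrite Rminus_0_r in Ha.
        rewrite Rmult_1_l. symmetry; apply is_pseries_unique; exact Ha.
    - destruct IHn as (h & Hh & E); [lia|].
      assert (H0 : PSeries h 0 = 0).
      { apply is_lim_seq_unique_R with (1 := PSeries_tau_lim h Hh).
        apply is_lim_seq_ext_loc with (fun i => G (tau i) / tau i ^ k * tau i ^ (k - n)).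
        - destruct (eventually_locally_0 _ _ E tau_lim) as [N HN]; exists N; intros i Hi.
          rewrite (HN i Hi).
          replace (tau i ^ k) with (tau i ^ n * tau i ^ (k - n))
            by (rewrite <- pow_add; f_equal; lia).
          field; split; apply pow_nonzero; pose proof (tau_pos i); lra.
        - replace 0 with (c * 0) by ring.
          apply is_lim_seq_mult'; [exact Lk | apply tau_pow_lim; lia]. }
      exists (PS_decr_1 h); split; [rewrite CV_radius_decr_1; exact Hh|].
      revert E; apply filter_imp; intros x E. rewrite E.
      rewrite PSeries_0 in H0.
      rewrite (PSeries_decr_1_aux h x H0). simpl; ring. }
  destruct (P k (Nat.le_refl k)) as (h & Hh & E).
  exists h; split; [exact Hh|]; split; [|exact E].
  apply is_lim_seq_unique_R with (1 := PSeries_tau_lim h Hh).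
  apply is_lim_seq_ext_loc with (2 := Lk).
  destruct (eventually_locally_0 _ _ E tau_lim) as [N HN]; exists N; intros i Hi.
  rewrite (HN i Hi); field; apply pow_nonzero; pose proof (tau_pos i); lra.
Qed.

(** Analyticity is what makes the asymptotics of [G] differentiable. *)
Lemma power_leading_derivative (k : nat) (c : R) (G : R -> R) :
  (1 <= k)%nat -> real_analytic_at G 0 -> power_leading k c G ->
  exists K, continuity_pt K 0 /\ K 0 = INR k * c /\
    locally 0 (fun x => is_derive G x (x ^ (k - 1) * K x)).
Proof.
  intros Hk Ha Hft.
  destruct (power_leading_factor k c G Ha Hft) as (h & Hh & H0 & E).
  exists (fun x => INR k * PSeries h x + x * PSeries (PS_derive h) x).
  split; [|split].
  - apply continuity_pt_plus; apply continuity_pt_mult.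
    + apply continuity_pt_const; intros u v; reflexivity.
    + apply PSeries_continuity; rewrite Rabs_R0; exact Hh.
    + apply derivable_continuous_pt, derivable_pt_id.
    + apply PSeries_continuity; rewrite Rabs_R0, CV_radius_derive; exact Hh.
  - rewrite H0; ring.
  - generalize (filter_and _ _ (locally_locally _ _ E) (inside_CV_radius h Hh)).
    apply filter_imp; intros x [E1 Hx].
    apply is_derive_ext_loc with (fun t => t ^ k * PSeries h t).
    { revert E1; apply filter_imp; intros t Et; symmetry; exact Et. }
    pose proof (is_derive_mult _ _ _ _ _ (is_derive_pow _ k _ _ (is_derive_id x))
      (is_derive_PSeries h x Hx) Rmult_comm) as D.
    match type of D with is_derive _ _ ?v => match goal with |- is_derive _ _ ?v' =>
      replace v' with v end end; [exact D|].
    change (INR k * 1 * x ^ pred k * PSeries h x + x ^ k * PSeries (PS_derive h) x =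
      x ^ (k - 1) * (INR k * PSeries h x + x * PSeries (PS_derive h) x)).
    destruct k as [|k]; [lia|]. simpl pred. replace (S k - 1)%nat with k by lia.
    change (x ^ S k) with (x * x ^ k). ring.
Qed.

(** Mean value theorem on the segment from [X n] to [X n + h n]: the intermediate point is
    still asymptotic to [X0 tau n], because [h n] is of higher order. *)
Lemma increment_limit (k j : nat) (G K : R -> R) (X h : nat -> R) (X0 H0 : R) :
  (1 <= k)%nat -> (1 <= j)%nat -> continuity_pt K 0 ->
  locally 0 (fun x => is_derive G x (x ^ (k - 1) * K x)) ->
  is_lim_seq (fun n => X n / tau n) X0 ->
  is_lim_seq (fun n => h n / tau n ^ (1 + j)) H0 ->
  is_lim_seq (fun n => (G (X n + h n) - G (X n)) / tau n ^ (k + j)) (X0 ^ (k - 1) * K 0 * H0).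
Proof.
  intros Hk Hj HK [d HG] HX Hh.
  assert (C : forall n, exists xi, Rabs (xi - X n) <= Rabs (h n) /\
    (Rabs (X n) + Rabs (h n) < d ->
      G (X n + h n) - G (X n) = xi ^ (k - 1) * K xi * h n)).
  { intro n. destruct (Rlt_dec (Rabs (X n) + Rabs (h n)) d) as [L | L].
    - assert (D : forall x, Rmin (X n) (X n + h n) <= x <= Rmax (X n) (X n + h n) ->
        Rabs (x - X n) <= Rabs (h n) /\ is_derive G x (x ^ (k - 1) * K x)).
      { intros x Hx.
        assert (B : Rabs (x - X n) <= Rabs (h n)).
        { unfold Rmin, Rmax in Hx; destruct (Rle_dec (X n) (X n + h n));
            unfold Rabs; repeat destruct Rcase_abs; lra. }
        split; [exact B|]. apply HG.
        change (Rabs (x - 0) < d).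
        replace (x - 0) with (X n + (x - X n)) by ring.
        apply Rle_lt_trans with (1 := Rabs_triang _ _). lra. }
      destruct (MVT_gen G (X n) (X n + h n) (fun x => x ^ (k - 1) * K x)) as (xi & Hxi & E).
      + intros x Hx; apply D; lra.
      + intros x Hx. apply continuity_pt_filterlim, (ex_derive_continuous (V := R_NormedModule)).
        eexists; apply D; exact Hx.
      + exists xi; split; [apply D; exact Hxi|].
        intros _; rewrite E; ring.
    - exists (X n); split; [|tauto].
      rewrite Rminus_diag_eq, Rabs_R0 by reflexivity; apply Rabs_pos. }
  (* The intermediate points are not unique and have to be chosen along the sequence. *)
  set (xi := fun n => proj1_sig (constructive_indefinite_description _ (C n))).
  assert (Cxi : forall n, Rabs (xi n - X n) <= Rabs (h n) /\
    (Rabs (X n) + Rabs (h n) < d ->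
      G (X n + h n) - G (X n) = xi n ^ (k - 1) * K (xi n) * h n))
    by (intro n; unfold xi; apply proj2_sig).
  clearbody xi.
  assert (Hht : is_lim_seq (fun n => h n / tau n) 0).
  { apply is_lim_seq_ext with (fun n => h n / tau n ^ (1 + j) * tau n ^ j).
    - intro n; pose proof (tau_pos n); pose proof (pow_lt (tau n) j H); simpl; field; lra.
    - replace 0 with (H0 * 0) by ring.
      apply is_lim_seq_mult'; [exact Hh | apply tau_pow_lim; exact Hj]. }
  assert (Hxt : is_lim_seq (fun n => xi n / tau n) X0).
  { apply is_lim_seq_ext with (fun n => (xi n - X n) / tau n + X n / tau n).
    - intro n; field; pose proof (tau_pos n); lra.
    - replace X0 with (0 + X0) by ring. apply is_lim_seq_plus'; [|exact HX].
      apply is_lim_seq_abs_0.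
      apply is_lim_seq_le_le with (u := fun _ => 0) (w := fun n => Rabs (h n / tau n)).
      + intro n; split; [apply Rabs_pos|]. unfold Rdiv; rewrite !Rabs_mult.
        apply Rmult_le_compat_r; [apply Rabs_pos | apply Cxi].
      + apply is_lim_seq_const.
      + rewrite <- Rabs_R0; apply (is_lim_seq_abs _ 0); exact Hht. }
  assert (LX := ratio_lim_to_0 _ _ HX). assert (Lh := ratio_lim_to_0 _ _ Hht).
  assert (Lxi := ratio_lim_to_0 _ _ Hxt).
  apply is_lim_seq_ext_loc with
    (fun n => (xi n / tau n) ^ (k - 1) * K (xi n) * (h n / tau n ^ (1 + j))).
  - assert (Ls : is_lim_seq (fun n => Rabs (X n) + Rabs (h n)) 0).
    { replace (Finite 0) with (Finite (Rabs 0 + Rabs 0)) by (rewrite Rabs_R0; f_equal; ring).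
      apply is_lim_seq_plus'; [exact (is_lim_seq_abs _ 0 LX) | exact (is_lim_seq_abs _ 0 Lh)]. }
    destruct (eventually_lt _ _ d Ls (cond_pos d)) as [N HN]; exists N; intros n Hn.
    destruct (Cxi n) as [_ E]. rewrite (E (HN n Hn)).
    replace (k + j)%nat with ((k - 1) + (1 + j))%nat by lia.
    rewrite (pow_add _ (k - 1) (1 + j)). unfold Rdiv.
    rewrite Rpow_mult_distr, pow_inv, Rinv_mult. ring.
  - apply is_lim_seq_mult'; [|exact Hh].
    apply is_lim_seq_mult'; [apply is_lim_seq_pow; exact Hxt|].
    apply is_lim_seq_continuous; assumption.
Qed.

(** * The Jacobian at the origin and the Levi-degenerate line *)

Lemma locally_origin_Cmod (P : C * C -> Prop) :
  locally origin P <->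
  exists d, 0 < d /\ forall z w, Cmod z < d -> Cmod w < d -> P (z, w).
Proof.
  split.
  - intros [d H]; exists d; split; [apply cond_pos|].
    intros z w Hz Hw; apply H.
    pose proof (re_le_Cmod z); pose proof (im_le_Cmod z).
    pose proof (re_le_Cmod w); pose proof (im_le_Cmod w).
    split; split; cbn;
      [change (Rabs (Re z - 0) < d) | change (Rabs (Im z - 0) < d)
      | change (Rabs (Re w - 0) < d) | change (Rabs (Im w - 0) < d)];
      rewrite Rminus_0_r; lra.
  - intros (d & Hd & H).
    assert (Hd2 : 0 < d / 2) by lra.
    exists (mkposreal _ Hd2). intros [z w] [[H1 H2] [H3 H4]].
    change (Rabs (Re z - 0) < d / 2) in H1. change (Rabs (Im z - 0) < d / 2) in H2.
    change (Rabs (Re w - 0) < d / 2) in H3. change (Rabs (Im w - 0) < d / 2) in H4.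
    rewrite Rminus_0_r in *.
    pose proof (Cmod_le_abs z); pose proof (Cmod_le_abs w).
    apply H; lra.
Qed.

Lemma eventually_origin (P : C * C -> Prop) (k : nat) (zn wn : nat -> C) (z w : C) :
  (1 <= k)%nat -> locally origin P -> C_lim zn z -> C_lim wn w ->
  eventually (fun n => P (RtoC (tau n) * zn n, RtoC (tau n ^ k) * wn n)%C).
Proof.
  intros Hk HP Hz Hw; apply locally_origin_Cmod in HP; destruct HP as (d & Hd & HP).
  destruct (C_lim_bounded _ _ Hz) as (r1 & R1 & N1 & B1).
  destruct (C_lim_bounded _ _ Hw) as (r2 & R2 & N2 & B2).
  destruct (eventually_lt _ _ (d / r1) tau_lim ltac:(apply Rdiv_lt_0_compat; lra)) as [N3 B3].
  destruct (eventually_lt _ _ (d / r2) (tau_pow_lim k Hk) ltac:(apply Rdiv_lt_0_compat; lra))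
    as [N4 B4].
  exists (N1 + N2 + N3 + N4)%nat; intros n Hn.
  specialize (B1 n ltac:(lia)); specialize (B2 n ltac:(lia)).
  specialize (B3 n ltac:(lia)); specialize (B4 n ltac:(lia)).
  pose proof (tau_pos n); pose proof (pow_lt _ k (tau_pos n)).
  apply HP; rewrite Cmod_mult, Cmod_R, Rabs_pos_eq by lra.
  - apply Rle_lt_trans with (tau n * r1); [apply Rmult_le_compat_l; lra|].
    replace d with (d / r1 * r1) by (field; lra). apply Rmult_lt_compat_r; lra.
  - apply Rle_lt_trans with (tau n ^ k * r2); [apply Rmult_le_compat_l; lra|].
    replace d with (d / r2 * r2) by (field; lra). apply Rmult_lt_compat_r; lra.
Qed.

Lemma expands_at_0 (a : nat -> nat -> C) (r : R) (f : C -> C -> C) :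
  0 < r -> expands a r f -> a 0%nat 0%nat = f 0%C 0%C.
Proof.
  intros Hr Hf.
  pose proof (leading_limit 1 a r f 0 (fun _ => 0%C) (fun _ => 0%C) 0 0
    ltac:(lia) Hr Hf ltac:(intros; lia) (C_lim_const _) (C_lim_const _)) as L.
  rewrite (weighted_part_single 1 a 0 0 0) in L; [|lia|lia|intros; lia].
  replace (a 0%nat 0%nat) with (a 0%nat 0%nat * 0 ^ 0 * 0 ^ 0)%C by (simpl; ring).
  apply (C_lim_unique _ _ _ L).
  apply C_lim_ext with (fun _ => f 0%C 0%C); [|apply C_lim_const].
  intro n. rewrite !Cmult_0_r. simpl. rewrite Rinv_1; ring.
Qed.

Lemma weighted_part_plus (k : nat) (a b : nat -> nat -> C) (N : nat) (z w : C) :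
  weighted_part k (fun m l => a m l + b m l)%C N z w =
  (weighted_part k a N z w + weighted_part k b N z w)%C.
Proof.
  unfold weighted_part. change (?x + ?y)%C with (plus (G := C_AbelianMonoid) x y) at 2.
  rewrite <- sum_n_plus; apply sum_n_ext; intro l.
  destruct (Nat.leb (k * l) N).
  - change (@plus C_AbelianMonoid) with Cplus.
    match goal with |- ?x = ?y => change (@eq C x y) end. unfold pterm2; ring.
  - symmetry; apply (plus_zero_l (G := C_AbelianMonoid)).
Qed.

Lemma weighted_part_pair (k : nat) (a : nat -> nat -> C) (z w : C) :
  (1 <= k)%nat -> weighted_part k a k z w = (a k 0%nat * z ^ k + a 0%nat 1%nat * w)%C.
Proof.
  intros Hk.
  transitivity (weighted_part k (fun m l => (if Nat.eqb l 0 then a m l else 0%C) +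
    (if Nat.eqb l 0 then 0%C else a m l))%C k z w).
  { apply weighted_part_ext; intros m l _; destruct (Nat.eqb l 0); ring. }
  rewrite weighted_part_plus, (weighted_part_single k _ k k 0), (weighted_part_single k _ k 0 1);
    [simpl; ring | lia | lia | | lia | lia |].
  - intros m l E Hl; destruct (Nat.eqb_spec l 0); [reflexivity|].
    exfalso; nia.
  - intros m l E Hl; destruct (Nat.eqb_spec l 0); [lia | reflexivity].
Qed.

(** Along a kernel vector [(z, w)] of the Jacobian matrix, [Psi (t z, t w)] is [o(t)].  The
    inverse map is Lipschitz at the origin and would give [(t z, t w) = o(t)]. *)
Lemma jacobian_injective (U V : C * C -> Prop) (Psi : C * C -> C * C)
  (a b : nat -> nat -> C) (r : R) (z w : C) :
  open U -> U origin -> Psi origin = origin -> biholomorphism U V Psi ->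
  0 < r -> expands a r (fun z w => fst (Psi (z, w))) ->
  expands b r (fun z w => snd (Psi (z, w))) ->
  (a 1%nat 0%nat * z + a 0%nat 1%nat * w = 0)%C ->
  (b 1%nat 0%nat * z + b 0%nat 1%nat * w = 0)%C ->
  z = 0%C /\ w = 0%C.
Proof.
  intros HU HU0 H0 (_ & HUV & Phi & HPhi & _ & HL & _) Hr Ha Hb Ea Eb.
  assert (V0 : V origin) by (rewrite <- H0; apply HUV; exact HU0).
  assert (P0 : Phi origin = origin) by (rewrite <- H0 at 1; apply HL; exact HU0).
  destruct (HPhi _ V0) as [H1 H2].
  destruct (holomorphic_expands _ H1) as (p & r1 & Hr1 & Hp).
  destruct (holomorphic_expands _ H2) as (q & r2 & Hr2 & Hq).
  assert (La := leading_limit 1 a r _ 1 (fun _ => z) (fun _ => w) z w (le_n _) Hr Ha).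
  assert (Lb := leading_limit 1 b r _ 1 (fun _ => z) (fun _ => w) z w (le_n _) Hr Hb).
  rewrite weighted_part_pair, Cpow_1_r, Ea in La by lia.
  rewrite weighted_part_pair, Cpow_1_r, Eb in Lb by lia.
  assert (La' := La ltac:(intros m l Hml; replace m with 0%nat by lia; replace l with 0%nat by lia;
    rewrite (expands_at_0 _ _ _ Hr Ha); change (RtoC 0, RtoC 0) with origin; rewrite H0;
    reflexivity) (C_lim_const _) (C_lim_const _)).
  assert (Lb' := Lb ltac:(intros m l Hml; replace m with 0%nat by lia; replace l with 0%nat by lia;
    rewrite (expands_at_0 _ _ _ Hr Hb); change (RtoC 0, RtoC 0) with origin; rewrite H0;
    reflexivity) (C_lim_const _) (C_lim_const _)).
  clear La Lb.
  assert (Lp := leading_limit 1 p r1 _ 1 _ _ _ _ (le_n _) Hr1 Hp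
    ltac:(intros m l Hml; replace m with 0%nat by lia; replace l with 0%nat by lia;
    rewrite (expands_at_0 _ _ _ Hr1 Hp); change (RtoC 0, RtoC 0) with origin; rewrite P0;
    reflexivity) La' Lb').
  assert (Lq := leading_limit 1 q r2 _ 1 _ _ _ _ (le_n _) Hr2 Hq
    ltac:(intros m l Hml; replace m with 0%nat by lia; replace l with 0%nat by lia;
    rewrite (expands_at_0 _ _ _ Hr2 Hq); change (RtoC 0, RtoC 0) with origin; rewrite P0;
    reflexivity) La' Lb').
  rewrite weighted_part_origin in Lp, Lq by lia.
  destruct (eventually_origin U 1 (fun _ => z) (fun _ => w) z w (le_n _) (HU _ HU0)
    (C_lim_const _) (C_lim_const _)) as [N HN].
  assert (E : forall n, (N <= n)%nat -> Phi
     (RtoC (tau n) * (RtoC (/ tau n ^ 1) *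
        fst (Psi (RtoC (tau n) * z, RtoC (tau n ^ 1) * w))),
      RtoC (tau n ^ 1) * (RtoC (/ tau n ^ 1) *
        snd (Psi (RtoC (tau n) * z, RtoC (tau n ^ 1) * w))))%C
      = (RtoC (tau n) * z, RtoC (tau n ^ 1) * w)%C).
  { intros n Hn. rewrite <- (HL _ (HN n Hn)) at 3. f_equal.
    rewrite (surjective_pairing (Psi _)) at 3.
    rewrite !Cmult_assoc, <- !RtoC_mult, pow_1, Rinv_r, !Cmult_1_l; [reflexivity|].
    pose proof (tau_pos n); lra. }
  assert (Fin : forall (v : C) (u : nat -> C),
     C_lim u 0 -> (forall n, (N <= n)%nat -> u n = v) -> v = 0%C).
  { intros v u Hu Eu. apply C_lim_unique with (2 := Hu).
    apply C_lim_Cmod_bound with (fun _ => v) (fun _ => 0);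
      [|apply is_lim_seq_const | apply C_lim_const].
    exists N; intros n Hn. rewrite Eu by exact Hn.
    replace (v - v)%C with (RtoC 0) by ring. rewrite Cmod_0; lra. }
  assert (T : forall n v, (RtoC (/ tau n ^ 1) * (RtoC (tau n) * v))%C = v).
  { intros n v. rewrite Cmult_assoc, <- RtoC_mult, pow_1, Rinv_l, Cmult_1_l; [reflexivity|].
    pose proof (tau_pos n); lra. }
  split.
  - apply Fin with (1 := Lp).
    intros n Hn. rewrite E by exact Hn. apply T.
  - apply Fin with (1 := Lq).
    intros n Hn. rewrite E by exact Hn. cbn [snd]. rewrite (pow_1 (tau n)) at 2. apply T.
Qed.

(** Derivative in [x], divided by [S n]. *)
Lemma levi_step (B : C) (e d p q : R) (n : nat) :
  (forall x, Im (B * (x, 1) ^ S n)%C + e * x ^ S n = d * (p * x + q) ^ S n) ->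
  forall x, Im (B * (x, 1) ^ n)%C + e * x ^ n = d * p * (p * x + q) ^ n.
Proof.
  intros H x.
  destruct (C_deriv_shift_pow B 1 x (S n)) as [_ H1].
  pose proof (is_derive_scal (fun t => t ^ S n) x e _
    (is_derive_pow _ (S n) _ _ (is_derive_id x))) as H2.
  assert (H3 : is_derive (fun t => p * t + q) x p) by (auto_derive; [exact I | ring]).
  pose proof (is_derive_scal (fun t => (p * t + q) ^ S n) x d _
    (is_derive_pow _ (S n) _ _ H3)) as H4.
  pose proof (is_derive_unique _ _ _ (is_derive_plus _ _ _ _ _ H1 H2)) as U1.
  pose proof (is_derive_unique _ _ _ H4) as U2.
  rewrite (Derive_ext _ (fun t => d * (p * t + q) ^ S n)) in U1 by exact H.
  rewrite U2 in U1. simpl pred in U1.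
  apply Rmult_eq_reg_l with (INR (S n)); [|apply not_0_INR; lia].
  rewrite Im_scal in U1.
  change (d * (INR (S n) * p * (p * x + q) ^ n) =
    INR (S n) * Im (B * (x, 1) ^ n)%C + e * (INR (S n) * 1 * x ^ n)) in U1.
  lra.
Qed.

(** Compare the value and the second derivative in [x] at [z = i].  As [i^k = - i^(k-2)], the
    unknown [B] cancels in the sum, which leaves
    [d |al|^2 (- Im al)^(k-2) = 0]; this uses [k > 2] twice, since otherwise the exponent is
    0 and the term with [e] survives. *)
Lemma levi_degenerate_line (B al : C) (e d : R) (k : nat) :
  (3 <= k)%nat -> d <> 0 -> al <> 0%C ->
  (forall x y, Im (B * (x, y) ^ k)%C + e * x ^ k = d * Re (al * (x, y))%C ^ k) ->
  Im al = 0 /\ B = 0%C.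
Proof.
  intros Hk Hd Hal H.
  assert (E : forall x y, Re (al * (x, y))%C = Re al * x + - Im al * y)
    by (intros; unfold Re, Im; simpl; ring).
  assert (Q : Im al = 0).
  { destruct k as [|[|n]]; [lia | lia |].
    assert (S0 : forall x, Im (B * (x, 1) ^ S (S n))%C + e * x ^ S (S n) =
      d * (Re al * x + - Im al) ^ S (S n)).
    { intro x; rewrite H, E, Rmult_1_r; reflexivity. }
    pose proof (levi_step _ _ _ _ _ _ (levi_step _ _ _ _ _ _ S0) 0) as S2.
    specialize (S0 0).
    rewrite pow_i, Rmult_0_r, Rmult_0_r, Rplus_0_r, Rplus_0_l in S0, S2 by lia.
    assert (I2 : Im (B * (0, 1) ^ S (S n))%C = - Im (B * (0, 1) ^ n)%C).
    { rewrite !Cpow_S. unfold Im; simpl; ring. }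
    rewrite I2, S2 in S0.
    assert (Z : d * ((- Im al) ^ n * (Re al ^ 2 + Im al ^ 2)) = 0).
    { simpl in S0 |- *. lra. }
    apply Rmult_integral in Z; destruct Z as [Z | Z]; [contradiction|].
    apply Rmult_integral in Z; destruct Z as [Z | Z].
    - destruct (Req_dec (Im al) 0) as [I | I]; [exact I|].
      exfalso; apply (pow_nonzero (- Im al) n); [lra | exact Z].
    - nra. }
  split; [exact Q|].
  (* [B (1 + i y)^k = B i^k (y - i)^k], whose imaginary part is constant in [y]. *)
  assert (Z : (- Ci * B * Ci ^ k)%C = 0%C).
  { apply Re_shift_pow_const with (-1) (d * Re al ^ k - e) k; [lra | lia |].
    intro u. specialize (H 1 u).
    rewrite E, Q, pow1, Rmult_1_r in H.
    replace (- Ci * B * Ci ^ k * (u, -1) ^ k)%C with (- Ci * (B * (1, u) ^ k))%C.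
    - rewrite <- Im_as_Re. replace (Re al * 1 + - 0 * u) with (Re al) in H by ring. lra.
    - replace ((1, u) : C) with (Ci * (u, -1))%C by (apply C_ext; unfold Re, Im; simpl; ring).
      rewrite Cpow_mult_l; ring. }
  assert (NZ : Ci <> 0%C) by (intro F; injection F; intros; lra).
  assert (NZk : (Ci ^ k)%C <> 0%C) by (apply Cpow_nz; exact NZ).
  replace B with ((- Ci * B * Ci ^ k) / (- Ci * Ci ^ k))%C.
  - rewrite Z. unfold Cdiv; ring.
  - field; auto.
Qed.

(** * The linear part of the map *)

(** The coordinate [w] of the point of [v = F x] with parameters
    [(tau n x, tau n y, tau n^k u)], after undoing the dilation. *)
Definition scaled_tube_w (F : R -> R) (k : nat) (x u : R) (n : nat) : C :=
  (u, F (tau n * x) / tau n ^ k).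

(** The mapping identity along the points to which [leading_limit] applies; they tend to
    the origin, so it follows from an identity of germs. *)
Definition maps_scaled_tube (k : nat) (F G : R -> R) (f g : C -> C -> C) : Prop :=
  forall x y u, eventually (fun n =>
    Im (g (RtoC (tau n) * (x, y)) (RtoC (tau n ^ k) * scaled_tube_w F k x u n))%C =
    G (Re (f (RtoC (tau n) * (x, y)) (RtoC (tau n ^ k) * scaled_tube_w F k x u n))%C)).

Lemma power_leading_scaled_lim (k : nat) (c : R) (F : R -> R) (x : R) :
  power_leading k c F -> is_lim_seq (fun n => F (tau n * x) / tau n ^ k) (c * x ^ k).
Proof. intros H; exact (power_leading_limit k c F _ x H (tau_ratio_lim x)). Qed.

Lemma scaled_tube_w_lim (k : nat) (c : R) (F : R -> R) (x u : R) :
  power_leading k c F -> C_lim (scaled_tube_w F k x u) (u, c * x ^ k).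
Proof.
  intros H; split; [apply is_lim_seq_const | exact (power_leading_scaled_lim k c F x H)].
Qed.

Lemma scaled_tube_w_Im (F : R -> R) (k : nat) (x u : R) (n : nat) :
  Im (RtoC (tau n ^ k) * scaled_tube_w F k x u n)%C = F (tau n * x).
Proof.
  rewrite Im_scal. unfold scaled_tube_w, Im; simpl.
  field; apply pow_nonzero; pose proof (tau_pos n); lra.
Qed.

Lemma maps_germ_scaled_tube (k : nat) (c : R) (F G : R -> R) (Psi : C * C -> C * C) :
  (1 <= k)%nat -> power_leading k c F -> maps_germ Psi (tube F) (tube G) ->
  maps_scaled_tube k F G (fun z w => fst (Psi (z, w))) (fun z w => snd (Psi (z, w))).
Proof.
  intros Hk HF H x y u.
  destruct (eventually_origin _ k (fun _ => (x, y) : C) (scaled_tube_w F k x u) _ _ Hk H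
    (C_lim_const _) (scaled_tube_w_lim k c F x u HF)) as [N HN].
  exists N; intros n Hn; apply (HN n Hn).
  unfold tube; cbn [fst snd]. rewrite scaled_tube_w_Im, re_scal_l. reflexivity.
Qed.

(** The argument [Re f] of [G] is [O(t)], so [G (Re f)] is [O(t^k)] and all parts of [g]
    below weight [k] have zero imaginary part on the model. *)
Lemma low_order_g (k : nat) (c1 c2 : R) (F G : R -> R) (f g : C -> C -> C)
  (a b : nat -> nat -> C) (r : R) :
  (2 <= k)%nat -> power_leading k c1 F -> power_leading k c2 G -> maps_scaled_tube k F G f g ->
  0 < r -> expands a r f -> expands b r g ->
  a 0%nat 0%nat = 0%C -> b 0%nat 0%nat = 0%C ->
  (forall m l, (m + k * l < k)%nat -> b m l = 0%C) /\
  forall x y u, Im (weighted_part k b k (x, y) (u, c1 * x ^ k)) =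
    c2 * Re (a 1%nat 0%nat * (x, y))%C ^ k.
Proof.
  intros Hk HF HG H Hr Hf Hg Ha Hb.
  (* The same quotient [G (Re f) / t^N] is computed through [g], here, and through [f], in [LG]. *)
  assert (L : forall N, (N <= k)%nat -> (forall m l, (m + k * l < N)%nat -> b m l = 0%C) ->
    forall x y u, is_lim_seq (fun n => G (Re (f (RtoC (tau n) * (x, y))
        (RtoC (tau n ^ k) * scaled_tube_w F k x u n))%C) / tau n ^ N)
      (Im (weighted_part k b N (x, y) (u, c1 * x ^ k)))).
  { intros N HN HbN x y u.
    destruct (leading_limit k b r g N (fun _ => (x, y) : C) _ _ _ ltac:(lia) Hr Hg HbN
      (C_lim_const _) (scaled_tube_w_lim k c1 F x u HF)) as [_ L].
    apply is_lim_seq_ext_loc with (2 := L).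
    destruct (H x y u) as [M HM]; exists M; intros n Hn.
    rewrite <- (HM n Hn), Im_scal. unfold Rdiv; ring. }
  assert (LX : forall x y u, is_lim_seq (fun n => Re (f (RtoC (tau n) * (x, y))
        (RtoC (tau n ^ k) * scaled_tube_w F k x u n))%C / tau n) (Re (a 1%nat 0%nat * (x, y))%C)).
  { intros x y u.
    destruct (leading_limit k a r f 1 (fun _ => (x, y) : C) _ _ _ ltac:(lia) Hr Hf
      ltac:(intros m l Hml; replace m with 0%nat by lia; replace l with 0%nat by nia; exact Ha)
      (C_lim_const _) (scaled_tube_w_lim k c1 F x u HF)) as [L1 _].
    rewrite (weighted_part_single k a 1 1 0) in L1; [|lia|lia|intros; nia].
    rewrite Cpow_1_r, Cmult_1_r in L1.
    apply is_lim_seq_ext with (2 := L1); intro n.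
    rewrite re_scal_l, pow_1. unfold Rdiv; ring. }
  assert (LG : forall x y u, is_lim_seq (fun n => G (Re (f (RtoC (tau n) * (x, y))
        (RtoC (tau n ^ k) * scaled_tube_w F k x u n))%C) / tau n ^ k)
        (c2 * Re (a 1%nat 0%nat * (x, y))%C ^ k)).
  { intros x y u; apply (power_leading_limit k c2 G _ _ HG (LX x y u)). }
  assert (B : forall N, (N <= k)%nat -> forall m l, (m + k * l < N)%nat -> b m l = 0%C).
  { induction N; intros HN m l E; [lia|].
    destruct (Nat.lt_ge_cases (m + k * l) N) as [E' | E']; [apply IHN; lia|].
    assert (l = 0%nat) by nia. subst l. assert (m = N) by lia. subst m.
    destruct (Nat.eq_dec N 0) as [-> | HN0]; [exact Hb|].
    assert (Z : forall x y u, Im (weighted_part k b N (x, y) (u, c1 * x ^ k)) = 0).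
    { intros x y u.
      apply is_lim_seq_unique_R with (1 := L N ltac:(lia) (IHN ltac:(lia)) x y u).
      replace 0 with (c2 * Re (a 1%nat 0%nat * (x, y))%C ^ k * 0) by ring.
      apply is_lim_seq_ext with (2 := is_lim_seq_mult' _ _ _ _ (LG x y u)
        (tau_pow_lim (k - N) ltac:(lia))).
      intro n. replace (tau n ^ k) with (tau n ^ N * tau n ^ (k - N))
        by (rewrite <- pow_add; f_equal; lia).
      field; split; apply pow_nonzero; pose proof (tau_pos n); lra. }
    assert (Z' : (- Ci * b N 0%nat)%C = 0%C).
    { apply Re_shift_pow_zero with 1 N; [lra | lia |].
      intro x. specialize (Z x 1 0).
      rewrite (weighted_part_single k b N N 0) in Z; [|lia|lia|intros m l E1 Hl; nia].
      rewrite <- Cmult_assoc, <- Im_as_Re.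
      refine (eq_trans _ Z). apply (f_equal Im); cbn [Cpow]; ring. }
    replace (b N 0%nat) with (Ci * (- Ci * b N 0%nat))%C.
    - rewrite Z'; ring.
    - apply C_ext; unfold Re, Im, Ci; simpl; ring. }
  split; [exact (B k (le_n k))|].
  intros x y u.
  exact (is_lim_seq_unique_R _ _ _ (L k (le_n k) (B k (le_n k)) x y u) (LG x y u)).
Qed.

Lemma linear_part (k : nat) (c1 c2 : R) (F G : R -> R) (f g : C -> C -> C)
  (a b : nat -> nat -> C) (r : R) :
  (3 <= k)%nat -> c2 <> 0 -> power_leading k c1 F -> power_leading k c2 G ->
  maps_scaled_tube k F G f g ->
  0 < r -> expands a r f -> expands b r g ->
  a 0%nat 0%nat = 0%C -> b 0%nat 0%nat = 0%C ->
  a 1%nat 0%nat <> 0%C ->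
  Im (a 1%nat 0%nat) = 0 /\ Im (b 0%nat 1%nat) = 0 /\ b k 0%nat = 0%C.
Proof.
  intros Hk Hc2 HF HG H Hr Hf Hg Ha Hb Hal.
  destruct (low_order_g k c1 c2 F G f g a b r) as [_ E]; try assumption; [lia|].
  assert (I : Im (b 0%nat 1%nat) = 0).
  { pose proof (E 0 0 0) as E0. pose proof (E 0 0 1) as E1.
    rewrite weighted_part_pair in E0, E1 by lia.
    assert (E2 : Im (b k 0%nat * (0, 0) ^ k)%C +
        (Re (b 0%nat 1%nat) * (c1 * 0 ^ k) + Im (b 0%nat 1%nat) * 1) =
      Im (b k 0%nat * (0, 0) ^ k)%C +
        (Re (b 0%nat 1%nat) * (c1 * 0 ^ k) + Im (b 0%nat 1%nat) * 0))
      by exact (eq_trans E1 (eq_sym E0)).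
    lra. }
  destruct (levi_degenerate_line (b k 0%nat) (a 1%nat 0%nat) (Re (b 0%nat 1%nat) * c1) c2 k)
    as [A1 B1]; try assumption.
  - intros x y. rewrite <- (E x y 0), weighted_part_pair, Im_plus by lia. f_equal.
    change (Re (b 0%nat 1%nat) * c1 * x ^ k =
      Re (b 0%nat 1%nat) * (c1 * x ^ k) + Im (b 0%nat 1%nat) * 0). ring.
  - auto.
Qed.

(** * Vanishing of the nonlinear part *)

(** Induction on the weight, one step being [model_rigidity]; the limit of
    [(G X - ga F) / t^(k+j)] is computed through two different points with the same [x]. *)
Lemma nonlinear_part_vanishes (k : nat) (c1 c2 al be ga : R) (F G : R -> R)
  (f g : C -> C -> C) (a b : nat -> nat -> C) (r : R) :
  (3 <= k)%nat -> c1 <> 0 -> c2 <> 0 -> al <> 0 ->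
  power_leading k c1 F -> power_leading k c2 G -> real_analytic_at G 0 ->
  maps_scaled_tube k F G (fun z w => RtoC al * z + Ci * RtoC be * w + f z w)%C
    (fun z w => RtoC ga * w + g z w)%C ->
  0 < r -> expands a r f -> expands b r g -> Im (a 0%nat 1%nat) = 0 ->
  (forall m l, (m + k * l < 2)%nat -> a m l = 0%C) ->
  (forall m l, (m + k * l < k + 1)%nat -> b m l = 0%C) ->
  forall m l, a m l = 0%C /\ b m l = 0%C.
Proof.
  intros Hk Hc1 Hc2 Hal HF HG HGa H Hr Hf Hg Ha1 Ha Hb.
  destruct (power_leading_derivative k c2 G ltac:(lia) HGa HG) as (K & HK & K0 & HD).
  assert (Q : forall j, (1 <= j)%nat ->
    (forall m l, (m + k * l < 1 + j)%nat -> a m l = 0%C) /\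
    (forall m l, (m + k * l < k + j)%nat -> b m l = 0%C)).
  { induction j as [|j IH]; intros Hj; [lia|].
    destruct (Nat.eq_dec j 0) as [-> | Hj0]; [split; [exact Ha | exact Hb]|].
    destruct (IH ltac:(lia)) as [IHa IHb].
    set (X := fun x n => al * (tau n * x) - be * F (tau n * x)).
    assert (LX : forall x, is_lim_seq (fun n => X x n / tau n) (al * x)).
    { intro x. unfold X.
      apply is_lim_seq_ext with (fun n => al * (tau n * x / tau n) -
        be * (F (tau n * x) / tau n ^ k * tau n ^ (k - 1))).
      - intro n. replace (tau n ^ k) with (tau n ^ (k - 1) * tau n).
        + field. pose proof (tau_pos n).
          split; [lra | apply pow_nonzero; lra].
        + rewrite <- (pow_1 (tau n)) at 2. rewrite <- pow_add; f_equal; lia.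
      - replace (al * x) with (al * x - be * (c1 * x ^ k * 0)) by ring.
        apply is_lim_seq_minus'; (apply is_lim_seq_mult'; [apply is_lim_seq_const|]).
        + apply tau_ratio_lim.
        + apply is_lim_seq_mult'; [apply (power_leading_scaled_lim k c1 F x HF)|].
          apply tau_pow_lim; lia. }
    assert (E : forall x y u, is_lim_seq (fun n =>
        (G (X x n) - ga * F (tau n * x)) / tau n ^ (k + j))
      (Im (weighted_part k b (k + j) (x, y) (u, c1 * x ^ k)) -
        INR k * c2 * al ^ (k - 1) * x ^ (k - 1) *
          Re (weighted_part k a (1 + j) (x, y) (u, c1 * x ^ k)))).
    { intros x y u.
      destruct (leading_limit k a r f (1 + j) (fun _ => (x, y) : C) _ _ _ ltac:(lia) Hr Hf IHa
        (C_lim_const _) (scaled_tube_w_lim k c1 F x u HF)) as [La _].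
      destruct (leading_limit k b r g (k + j) (fun _ => (x, y) : C) _ _ _ ltac:(lia) Hr Hg IHb
        (C_lim_const _) (scaled_tube_w_lim k c1 F x u HF)) as [_ Lb].
      set (h := fun n => Re (f (RtoC (tau n) * (x, y))
        (RtoC (tau n ^ k) * scaled_tube_w F k x u n))%C).
      assert (Lh : is_lim_seq (fun n => h n / tau n ^ (1 + j))
        (Re (weighted_part k a (1 + j) (x, y) (u, c1 * x ^ k)))).
      { apply is_lim_seq_ext with (2 := La); intro n.
        rewrite re_scal_l. unfold h, Rdiv; ring. }
      pose proof (increment_limit k j G K (X x) h _ _ ltac:(lia) ltac:(lia) HK HD (LX x) Lh) as LG.
      rewrite K0 in LG.
      pose proof (is_lim_seq_minus' _ _ _ _ Lb LG) as LL.
      match type of LL with is_lim_seq _ (Finite ?v) => match goal with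
        |- is_lim_seq _ (Finite ?v') => replace v' with v end end.
      - apply is_lim_seq_ext_loc with (2 := LL).
        destruct (H x y u) as [N HN]; exists N; intros n Hn.
        specialize (HN n Hn). cbv beta in HN.
        rewrite Im_plus, Im_scal, scaled_tube_w_Im in HN.
        rewrite !Re_plus, re_scal_l, <- Cmult_assoc, Re_Ci_mult, Im_scal, scaled_tube_w_Im in HN.
        rewrite re_scal_l in HN. change (Re (x, y)) with x in HN.
        rewrite Im_scal. unfold X.
        unfold h at 1.
        replace (al * (tau n * x) - be * F (tau n * x)) with
          (al * (tau n * x) + - (be * F (tau n * x))) by ring.
        rewrite <- HN. unfold Rdiv; ring.
      - rewrite Rpow_mult_distr; ring. }
    destruct (model_rigidity k j c1 (INR k * c2 * al ^ (k - 1)) a b) as [Ra Rb]; auto.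
    - apply Rmult_integral_contrapositive; split; [|apply pow_nonzero; exact Hal].
      apply Rmult_integral_contrapositive; split; [apply not_0_INR; lia | exact Hc2].
    - lia.
    - intros x y u y' u'.
      exact (is_lim_seq_unique_R _ _ _ (E x y u) (E x y' u')).
    - split; intros m l Hml.
      + destruct (Nat.eq_dec (m + k * l) (1 + j)); [apply Ra; assumption | apply IHa; lia].
      + destruct (Nat.eq_dec (m + k * l) (k + j)); [apply Rb; assumption | apply IHb; lia]. }
  intros m l. destruct (Q (S (m + k * l)) ltac:(lia)) as [Qa Qb].
  split; [apply Qa | apply Qb]; lia.
Qed.

Lemma expands_zero (a : nat -> nat -> C) (r : R) (f : C -> C -> C) (z w : C) :
  expands a r f -> (forall m l, a m l = 0%C) -> Cmod z < r -> Cmod w < r -> f z w = 0%C.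
Proof.
  intros Hf Ha Hz Hw. destruct (Hf z w Hz Hw) as [_ H].
  assert (B : Cmod (f z w) <= 0 * 1).
  { apply (series_Cmod_le _ _ (fun n => if Nat.eqb n 0 then 1 else 0) 1 0 H).
    - exact (is_series_single (K := R_AbsRing) (V := R_NormedModule) 1 0).
    - lra.
    - intro n; destruct (Nat.eqb n 0); lra.
    - intro n. rewrite Rmult_0_l. right.
      rewrite (sum_n_ext (G := C_AbelianMonoid) _ (fun _ => zero)).
      + transitivity (Cmod 0); [f_equal | apply Cmod_0].
        induction n; [rewrite sum_O; reflexivity|].
        rewrite sum_Sn, IHn. apply (plus_zero_l (G := C_AbelianMonoid)).
      + intro m. unfold pterm2; rewrite Ha.
        change (@zero C_AbelianMonoid) with (RtoC 0).
        match goal with |- ?x = ?y => change (@eq C x y) end; ring. }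
  apply Cmod_eq_0. pose proof (Cmod_ge_0 (f z w)). lra.
Qed.

Theorem proposition5p1 (k : nat) (F G : R -> R) (Psi : C * C -> C * C)
  (hk : (2 < k)%nat)
  (hF : analytic_tube_at_origin F) (hFk : finite_type k F)
  (hG : analytic_tube_at_origin G) (hGk : finite_type k G)
  (hPsi : local_biholomorphism_at origin Psi)
  (hPsi0 : Psi origin = origin)
  (hmap : maps_germ Psi (tube F) (tube G)) :
  exists a b c : R, a <> 0 /\ c <> 0 /\
    locally origin (fun p : C * C =>
      Psi p = ((RtoC a * fst p + Ci * RtoC b * snd p)%C, (RtoC c * snd p)%C)) /\
    locally 0 (fun x : R => G (a * x - b * F x) = c * F x).
Proof.
  destruct hFk as (c1 & Hc1 & HF), hGk as (c2 & Hc2 & HG).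
  change (power_leading k c1 F) in HF; change (power_leading k c2 G) in HG.
  destruct hPsi as (U & V & HU & _ & HU0 & HB).
  assert (HPsi := HB); destruct HPsi as [HPsi _].
  destruct (HPsi _ HU0) as [H1 H2].
  destruct (holomorphic_expands _ H1) as (a & r1 & Hr1 & Ha0).
  destruct (holomorphic_expands _ H2) as (b & r2 & Hr2 & Hb0).
  set (r := Rmin r1 r2).
  assert (Hr : 0 < r) by (apply Rmin_glb_lt; assumption).
  assert (Ha := expands_shrink a r1 r _ (Rmin_l _ _) Ha0).
  assert (Hb := expands_shrink b r2 r _ (Rmin_r _ _) Hb0).
  assert (A0 : a 0%nat 0%nat = 0%C)
    by (rewrite (expands_at_0 _ _ _ Hr Ha); fold origin; rewrite hPsi0; reflexivity).
  assert (B0 : b 0%nat 0%nat = 0%C)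
    by (rewrite (expands_at_0 _ _ _ Hr Hb); fold origin; rewrite hPsi0; reflexivity).
  assert (HM := maps_germ_scaled_tube k c1 F G Psi ltac:(lia) HF hmap).
  assert (J := fun z w => jacobian_injective U V Psi a b r z w HU HU0 hPsi0 HB Hr Ha Hb).
  destruct (low_order_g k c1 c2 F G _ _ a b r ltac:(lia) HF HG HM Hr Ha Hb A0 B0) as [Blow _].
  assert (B10 : b 1%nat 0%nat = 0%C) by (apply Blow; lia).
  assert (A10 : a 1%nat 0%nat <> 0%C).
  { intro E. destruct (J 1%C 0%C) as [F1 _]; rewrite ?E, ?B10; try ring.
    injection F1; intros; lra. }
  assert (B01 : b 0%nat 1%nat <> 0%C).
  (* A kernel vector of the matrix with rows [(a10, a01)] and [(0, 0)]. *)
  { intro E. destruct (J (- a 0%nat 1%nat)%C (a 1%nat 0%nat)) as [_ F1];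
      rewrite ?E, ?B10; try ring. contradiction. }
  destruct (linear_part k c1 c2 F G _ _ a b r ltac:(lia) Hc2 HF HG HM Hr Ha Hb A0 B0 A10)
    as (I1 & I2 & Bk).
  set (al := Re (a 1%nat 0%nat)). set (be := Im (a 0%nat 1%nat)). set (ga := Re (b 0%nat 1%nat)).
  assert (Eal : a 1%nat 0%nat = RtoC al) by (apply C_ext; [reflexivity | exact I1]).
  assert (Ega : b 0%nat 1%nat = RtoC ga) by (apply C_ext; [reflexivity | exact I2]).
  assert (Nal : al <> 0) by (intro E; apply A10; rewrite Eal, E; reflexivity).
  assert (Nga : ga <> 0) by (intro E; apply B01; rewrite Ega, E; reflexivity).
  pose proof (expands_lin _ _ (-1)%C _ _ _ (expands_lin _ _ (-1)%C _ _ _ Ha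
    (expands_monomial (RtoC al) 1 0 r)) (expands_monomial (Ci * RtoC be)%C 0 1 r)) as Ha'.
  pose proof (expands_lin _ _ (-1)%C _ _ _ Hb (expands_monomial (RtoC ga) 0 1 r)) as Hb'.
  match type of Ha' with expands ?x _ ?y => set (a' := x) in Ha'; set (f := y) in Ha' end.
  match type of Hb' with expands ?x _ ?y => set (b' := x) in Hb'; set (g := y) in Hb' end.
  assert (Ef : forall z w, fst (Psi (z, w)) = (RtoC al * z + Ci * RtoC be * w + f z w)%C)
    by (intros; unfold f; simpl; ring).
  assert (Eg : forall z w, snd (Psi (z, w)) = (RtoC ga * w + g z w)%C)
    by (intros; unfold g; simpl; ring).
  assert (Z : forall m l, a' m l = 0%C /\ b' m l = 0%C).
  { apply (nonlinear_part_vanishes k c1 c2 al be ga F G f g a' b' r); try assumption; try lia.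
    - apply (locally_singleton _ _ (proj1 hG)).
    - intros x y u. destruct (HM x y u) as [N HN]; exists N; intros n Hn.
      specialize (HN n Hn); cbv beta in HN |- *. rewrite <- Ef, <- Eg; exact HN.
    - assert (I0 : forall v : C, Im (v + -1 * 0 + -1 * (Ci * RtoC (Im v)))%C = 0)
        by (intro v; unfold Im; simpl; ring).
      exact (I0 (a 0%nat 1%nat)).
    - intros m l Hml. assert (l = 0%nat) by nia. subst l.
      unfold a', monomial_coef. destruct m as [|[|m]]; [| |lia]; cbn [Nat.eqb].
      + rewrite A0; ring.
      + rewrite Eal; ring.
    - intros m l Hml. unfold b', monomial_coef.
      destruct (Nat.lt_ge_cases (m + k * l) k) as [L | L].
      + rewrite Blow by exact L. destruct m; cbn [Nat.eqb]; [|ring].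
        destruct l as [|[|l]]; cbn [Nat.eqb]; [ring | lia | ring].
      + destruct l as [|[|l]]; [| |nia].
        * replace m with k by lia. rewrite Bk. destruct k; [lia|]; cbn [Nat.eqb]; ring.
        * replace m with 0%nat by lia. cbn [Nat.eqb]. rewrite Ega; ring. }
  assert (Form : forall z w, Cmod z < r -> Cmod w < r ->
    Psi (z, w) = ((RtoC al * z + Ci * RtoC be * w)%C, (RtoC ga * w)%C)).
  { intros z w Hz Hw. rewrite (surjective_pairing (Psi (z, w))), Ef, Eg.
    rewrite (expands_zero a' r f z w Ha' (fun m l => proj1 (Z m l)) Hz Hw).
    rewrite (expands_zero b' r g z w Hb' (fun m l => proj2 (Z m l)) Hz Hw).
    f_equal; ring. }
  exists al, be, ga; split; [exact Nal|]; split; [exact Nga|]; split.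
  - apply locally_origin_Cmod; exists r; split; [exact Hr|].
    intros z w Hz Hw; exact (Form z w Hz Hw).
  - apply locally_origin_Cmod in hmap; destruct hmap as (d & Hd & Hmap).
    set (e := Rmin r d).
    assert (He : 0 < e) by (apply Rmin_glb_lt; assumption).
    assert (Er : e <= r) by apply Rmin_l. assert (Ed : e <= d) by apply Rmin_r.
    destruct hF as (_ & F0 & DF).
    assert (CF : locally 0 (fun x => Rabs (F x) < e)).
    { assert (C0 := ex_derive_continuous F 0 (ex_intro _ _ DF)).
      apply (C0 (fun v => Rabs v < e)). rewrite F0.
      exists (mkposreal e He); intros v Hv.
      change (Rabs (v - 0) < e) in Hv. rewrite Rminus_0_r in Hv; exact Hv. }
    assert (CX : locally 0 (fun x : R => Rabs x < e)).
    { exists (mkposreal e He); intros v Hv.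
      change (Rabs (v - 0) < e) in Hv. rewrite Rminus_0_r in Hv; exact Hv. }
    generalize (filter_and _ _ CF CX); apply filter_imp; intros x [X1 X2].
    assert (M1 : Cmod (RtoC x) < e) by (rewrite Cmod_R; exact X2).
    assert (M2 : Cmod (Ci * RtoC (F x)) < e) by (rewrite Cmod_mult, Cmod_Ci, Cmod_R; lra).
    specialize (Hmap (RtoC x) (Ci * RtoC (F x))%C ltac:(lra) ltac:(lra)).
    rewrite Form in Hmap by lra.
    unfold tube in Hmap; cbn [fst snd] in Hmap.
    rewrite Im_scal, Im_Ci_mult, Re_plus, re_scal_l, <- Cmult_assoc, Re_Ci_mult, Im_scal,
      Im_Ci_mult in Hmap.
    change (Re (RtoC x)) with x in Hmap. change (Re (RtoC (F x))) with (F x) in Hmap.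
    symmetry; rewrite (Hmap eq_refl). f_equal; ring.
Qed.
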